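(* Let $A$ and $B$ be standard graded polynomial rings over a field $k$ and let $R=A\otimes_k B$. Let $I\subset A$ and $J\subset B$ be nonzero proper homogeneous ideals. Then $$\hat{\alpha}(I+J)=\min\{\hat{\alpha}(I),\hat{\alpha}(J)\}.$$
   Context: Polynomial rings are in finitely many variables; $R$ is the polynomial ring in the disjoint union of the two sets of variables, and $I+J$ denotes the ideal of $R$ generated by $I$ and $J$. For a nonzero proper homogeneous ideal $Q$ of a standard graded polynomial ring, $\alpha(Q)=\min\{d\mid Q_d\neq 0\}$ is the smallest degree of a nonzero element of $Q$, and the Waldschmidt constant of $Q$ is $\hat\alpha(Q)=\lim_{m\to\infty}\alpha(Q^{(m)})/m$ (this limit exists). Here, for an ideal $Q$ of a Noetherian ring $S$, the symbolic power is $Q^{(m)}=S\cap\bigcap_{P\in\operatorname{Min}(Q)}Q^mS_P$, where $\operatorname{Min}(Q)$ is the set of minimal primes of $Q$. *)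

(* Defs.v *)
From HB Require Import structures.
From mathcomp Require Import all_boot all_order all_algebra.
(* mpoly must be imported before the analysis files: in the other order their
   notations clash. *)
From mathcomp Require Import mpoly.
From mathcomp Require Import boolp classical_sets reals topology normedtype.
From mathcomp Require Import sequences.

Set Implicit Arguments.
Unset Strict Implicit.
Unset Printing Implicit Defensive.

Import Order.TTheory GRing.Theory Num.Theory.
Import numFieldNormedType.Exports.

Local Open Scope classical_set_scope.
Local Open Scope ring_scope.

(* Possibly improper ideals, i.e. submodules of the regular module; the
   library's [idealr_closed] also requires [1] not to be a member. *)
Definition ideal (S : comNzRingType) (Q : set S) : Prop :=
  submod_closed (mem Q : {pred S^o}).

Definition ideal_gen (S : comNzRingType) (X : set S) : set S :=
  smallest (@ideal S) X.

Definition ideal_pow (S : comNzRingType) (Q : set S) (m : nat) : set S :=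
  ideal_gen [set \prod_(i < m) f i |
              f in [set f : 'I_m -> S | forall i, Q (f i)]].

Definition prime_ideal (S : comNzRingType) (P : set S) : Prop :=
  idealr_closed (mem P) /\ prime_idealr_closed (mem P).

Definition minimal_prime (S : comNzRingType) (Q P : set S) : Prop :=
  [/\ prime_ideal P, Q `<=` P &
      forall P', prime_ideal P' -> Q `<=` P' -> P' `<=` P -> P' = P].

(* For a prime P of a domain S, the localization S_P as a subring of the
   fraction field of S. *)
Definition localization (S : idomainType) (P : set S) : set {fraction S} :=
  [set x | exists a s : S, ~ P s /\ x = tofrac a / tofrac s].

(* The extended ideal Q S_P of S_P. *)
Definition extended_ideal (S : idomainType) (P Q : set S) :
    set {fraction S} :=
  [set x | exists (n : nat) (q : 'I_n -> S) (c : 'I_n -> {fraction S}),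
    [/\ forall i, Q (q i), forall i, localization P (c i) &
        x = \sum_(i < n) tofrac (q i) * c i]].

Definition symbolic_power (S : idomainType) (Q : set S) (m : nat) : set S :=
  [set f | forall P, minimal_prime Q P ->
             extended_ideal P (ideal_pow Q m) (tofrac f)].

Section Graded.
Variable k : fieldType.

Definition homogeneous_ideal (n : nat) (Q : set {mpoly k[n]}) : Prop :=
  ideal Q /\ forall f, Q f -> forall d, Q (pihomog mdeg d f).

(* The degrees d such that Q_d <> 0. *)
Definition degrees (n : nat) (Q : set {mpoly k[n]}) : set nat :=
  [set d | exists f, [/\ Q f, f \is d.-homog for mdeg & f != 0]].

(* The least element of [degrees Q], with junk value 0 if there is none. *)
Definition alpha (n : nat) (Q : set {mpoly k[n]}) : nat :=
  xget 0%N [set d | degrees Q d /\ forall e, degrees Q e -> (d <= e)%N].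

Definition waldschmidt (R : realType) (n : nat) (Q : set {mpoly k[n]}) : R :=
  limn (fun m : nat => (alpha (symbolic_power Q m))%:R / m%:R : R).

(* The tensor product k[x_1..x_n] (x) k[y_1..y_p] is the polynomial ring in
   n + p variables, the x's being the first n and the y's the last p. *)
Definition inl_mpoly (n p : nat) (f : {mpoly k[n]}) : {mpoly k[n + p]} :=
  f \mPo [tuple 'X_(lshift p i) | i < n].

Definition inr_mpoly (n p : nat) (g : {mpoly k[p]}) : {mpoly k[n + p]} :=
  g \mPo [tuple 'X_(rshift n i) | i < p].

Arguments inl_mpoly {n} p f.
Arguments inr_mpoly n {p} g.

Definition ideal_sum (n p : nat) (I : set {mpoly k[n]}) (J : set {mpoly k[p]}) :
    set {mpoly k[n + p]} :=
  ideal_gen (inl_mpoly p @` I `|` inr_mpoly n @` J).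

End Graded.

(* Main.v *)
Require Import Defs.
From mathcomp Require Import all_boot all_order all_algebra.
From mathcomp Require Import mpoly.
From mathcomp Require Import boolp classical_sets reals topology normedtype.
From mathcomp Require Import sequences.
From HB Require Import structures.
From mathcomp Require Import ring lra zify.

(* Write [A = k[x]], [B = k[y]] and [R = A (x) B].  Everything rests on the
   containments, for [a + b = m + 1],
     I^(m) R  <=  (I + J)^(m)  <=  I^(a) R + J^(b) R.
   The first holds because a minimal prime of [I + J] contracts to a minimal prime
   of [I].  For the second, [(I + J)^m <= I^a R + J^b R], and it is enough to see
   that if [F] is [P1]-primary in [A] and [G] is [P2]-primary in [B], for minimal
   primes [P1] of [I] and [P2] of [J], then [F R + G R] is unmixed: for [x] outside
   it, the colon ideal [(F R + G R : x)] lies in a minimal prime of [I + J].  To see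
   this, choose a maximal set [T] of variables [x_i] independent modulo [P1]; then
   the elements of [k[T] (x) B] outside [P2 R] are regular modulo [F R + G R], while
   [R / (P1 R + P2 R)] is algebraic over [k[T] (x) (B / P2)].
   An element of degree [d] of the right-hand side has a monomial of [x]-degree at
   least [alpha(I^(a))] or of [y]-degree at least [alpha(J^(b))]; letting [a] vary,
   [d >= alpha(I^(a)) + alpha(J^(b))] for some [a + b = m], and the theorem follows
   by Fekete's lemma. *)

Set Implicit Arguments.
Unset Strict Implicit.
Unset Printing Implicit Defensive.

Import Order.TTheory GRing.Theory Num.Theory.
Import numFieldNormedType.Exports.

Local Open Scope classical_set_scope.
Local Open Scope ring_scope.

(** * Ideals, primary ideals and symbolic powers *)

Section Ideals.
Variable S : comNzRingType.
Implicit Types (P Q F : set S).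

Lemma idealP Q : ideal Q <->
  [/\ Q 0, forall x y, Q x -> Q y -> Q (x + y) & forall a x, Q x -> Q (a * x)].
Proof.
split=> [[Q0 QD]|[Q0 QD QM]].
  rewrite inE in Q0; split=> // [x y Qx Qy|a x Qx].
    by have := QD 1 x y; rewrite !inE scale1r; apply.
  by have := QD a x 0; rewrite !inE addr0; apply.
split=> [|a x y]; rewrite !inE // => Qx Qy.
by apply: QD => //; apply: QM.
Qed.

Lemma ideal0 Q : ideal Q -> Q 0. Proof. by case/idealP. Qed.
Lemma idealD Q x y : ideal Q -> Q x -> Q y -> Q (x + y).
Proof. by case/idealP=> _ H _; apply: H. Qed.
Lemma idealMl Q a x : ideal Q -> Q x -> Q (a * x).
Proof. by case/idealP=> _ _ H; apply: H. Qed.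
Lemma idealMr Q a x : ideal Q -> Q x -> Q (x * a).
Proof. by rewrite mulrC; apply: idealMl. Qed.
Lemma idealN Q x : ideal Q -> Q x -> Q (- x).
Proof. by rewrite -mulN1r; apply: idealMl. Qed.
Lemma idealB Q x y : ideal Q -> Q x -> Q y -> Q (x - y).
Proof. by move=> iQ Qx Qy; apply: idealD => //; apply: idealN. Qed.
Lemma ideal_sum_closed Q (T : Type) (r : seq T) (p : pred T) (f : T -> S) :
  ideal Q -> (forall i, p i -> Q (f i)) -> Q (\sum_(i <- r | p i) f i).
Proof.
by move=> iQ Qf; elim/big_ind: _ => //;
  [apply: ideal0 | move=> x y; apply: idealD].
Qed.
Lemma idealBr Q x y : ideal Q -> Q x -> Q (x + y) <-> Q y.
Proof.
move=> iQ Qx; split=> [Qxy|]; last exact: idealD.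
by rewrite -[y](addKr x) addrC; apply: idealB.
Qed.

Lemma prime_idealP P : prime_ideal P <->
  [/\ ideal P, ~ P 1 & forall x y, P (x * y) -> P x \/ P y].
Proof.
split=> [[[P0 P1 PD] PM]|[iP P1 PM]].
  rewrite inE in P0; rewrite notin_setE in P1; split=> //.
    apply/idealP; split=> // [x y Px Py|a x Px].
      by have := PD 1 x y; rewrite !inE mul1r; apply.
    by have := PD a x 0; rewrite !inE addr0; apply.
  by move=> x y Pxy; have := PM x y; rewrite !inE => /(_ Pxy) /orP[];
    rewrite inE; [left|right].
split.
  split; rewrite ?inE ?notin_setE //; first exact: ideal0.
  by move=> a x y; rewrite !inE => Px Py; apply: idealD => //; apply: idealMl.
move=> x y; rewrite inE => /PM[Px|Py]; apply/orP; [left|right]; by rewrite inE.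
Qed.

Lemma prime_idealW P : prime_ideal P -> ideal P.
Proof. by case/prime_idealP. Qed.
Lemma prime_ideal1 P : prime_ideal P -> ~ P 1.
Proof. by case/prime_idealP. Qed.
Lemma prime_idealM P x y : prime_ideal P -> P (x * y) -> P x \/ P y.
Proof. by case/prime_idealP=> _ _ H; apply: H. Qed.
Lemma prime_idealMN P x y : prime_ideal P -> ~ P x -> ~ P y -> ~ P (x * y).
Proof. by move=> pP Px Py /(prime_idealM pP)[]. Qed.
Lemma prime_idealX P x m : prime_ideal P -> P (x ^+ m) -> P x.
Proof.
move=> pP; elim: m => [|m IH]; first by rewrite expr0 => /(prime_ideal1 pP).
by rewrite exprS => /(prime_idealM pP)[].
Qed.
Lemma prime_ideal_prodN P (T : Type) (r : seq T) (f : T -> S) :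
  prime_ideal P -> (forall i, ~ P (f i)) -> ~ P (\prod_(i <- r) f i).
Proof.
move=> pP Pf; elim/big_ind: _ => // [|x y]; first exact: prime_ideal1.
exact: prime_idealMN.
Qed.

Lemma ideal_gen_sub (X : set S) : X `<=` ideal_gen X.
Proof. exact: sub_smallest. Qed.

Lemma ideal_gen_min (X Q : set S) : ideal Q -> X `<=` Q -> ideal_gen X `<=` Q.
Proof. by move=> iQ XQ; apply: smallest_sub. Qed.

Lemma ideal_gen_ideal (X : set S) : ideal (ideal_gen X).
Proof.
apply/(idealP (ideal_gen X)); split=> [|x y Hx Hy|a x Hx] Q [iQ XQ].
- exact: ideal0.
- by apply: idealD => //; [apply: Hx | apply: Hy].
- by apply: idealMl => //; apply: Hx.
Qed.

Lemma ideal_pow_ideal Q m : ideal (ideal_pow Q m).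
Proof. exact: ideal_gen_ideal. Qed.

Lemma ideal_pow_prod Q m (f : 'I_m -> S) :
  (forall i, Q (f i)) -> ideal_pow Q m (\prod_(i < m) f i).
Proof. by move=> Qf X [_]; apply; exists f. Qed.

Lemma ideal_pow_min Q m F : ideal F ->
  (forall f : 'I_m -> S, (forall i, Q (f i)) -> F (\prod_(i < m) f i)) ->
  ideal_pow Q m `<=` F.
Proof. by move=> iF HF; apply: (ideal_gen_min iF) => _ [f Qf <-]; apply: HF. Qed.

Lemma ideal_pow0 Q x : ideal_pow Q 0 x.
Proof.
rewrite -[x]mulr1; apply: (idealMl _ (ideal_pow_ideal Q 0)).
by have := @ideal_pow_prod Q 0 (fun=> 1); rewrite big_ord0; apply; case.
Qed.

Lemma ideal_powM Q a b x y :
  ideal_pow Q a x -> ideal_pow Q b y -> ideal_pow Q (a + b) (x * y).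
Proof.
pose F x := forall y, ideal_pow Q b y -> ideal_pow Q (a + b) (x * y).
have iP := ideal_pow_ideal Q (a + b).
suff: ideal_pow Q a `<=` F by move=> H /H; apply.
apply: ideal_pow_min.
  apply/idealP; split=> [z|u v Fu Fv z Qz|c u Fu z Qz].
  - by rewrite mul0r => _; apply: ideal0 iP.
  - by rewrite mulrDl; apply: (idealD iP); [apply: Fu|apply: Fv].
  - by rewrite -mulrA; apply: (idealMl _ iP); apply: Fu.
move=> f Qf z; move: z; apply: ideal_pow_min.
  apply/idealP; split=> [|u v|c u].
  - by rewrite mulr0; apply: ideal0 iP.
  - by rewrite mulrDr; apply: idealD iP.
  - by rewrite mulrCA; apply: idealMl iP.
move=> g Qg.
pose h (i : 'I_(a + b)) := match split i with inl j => f j | inr j => g j end.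
have <- : \prod_i h i = \prod_i f i * \prod_i g i.
  rewrite big_split_ord /h; congr (_ * _); apply: eq_bigr => i _.
    by rewrite -/(unsplit (inl i)) unsplitK.
  by rewrite -/(unsplit (inr i)) unsplitK.
by apply: ideal_pow_prod => i; rewrite /h; case: (split i).
Qed.

Lemma ideal_pow1 Q x : Q x -> ideal_pow Q 1 x.
Proof.
move=> Qx; have := @ideal_pow_prod Q 1 (fun=> x).
by rewrite big_ord1; apply.
Qed.

Lemma ideal_powS Q m x y : Q x -> ideal_pow Q m y -> ideal_pow Q m.+1 (x * y).
Proof. by move=> /ideal_pow1 Qx; rewrite -add1n; apply: ideal_powM. Qed.

Lemma ideal_powX Q m x : Q x -> ideal_pow Q m (x ^+ m).
Proof.
move=> Qx; have := @ideal_pow_prod Q m (fun=> x).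
by rewrite prodr_const card_ord; apply.
Qed.

(** An ideal maximal among those that contain [Q] and miss the multiplicative set [M] is prime;
    Zorn's lemma provides one. *)
Lemma prime_avoiding (Q M : set S) : ideal Q -> M 1 ->
  (forall x y, M x -> M y -> M (x * y)) -> (forall x, Q x -> ~ M x) ->
  exists P, [/\ prime_ideal P, Q `<=` P & forall x, P x -> ~ M x].
Proof.
move=> iQ M1 MM QM.
pose good X := [/\ ideal X, Q `<=` X & forall x, X x -> ~ M x].
have [|A [gA Amax]] := @Zorn_bigcup S [set X | X = set0 \/ good X].
  move=> F FP Ftot.
  have [[X0 FX0 [x0 X0x0]]|noX] := pselect (exists2 X, F X & X !=set0); last first.
    left; rewrite -subset0 => x [X FX Xx]; apply: noX.
    by exists X => //; exists x.
  have gF X : F X -> X !=set0 -> good X.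
    by move=> /FP[->|//] [x []].
  have [iX0 QX0 MX0] : good X0 by apply: gF => //; exists x0.
  right; split.
  - apply/idealP; split=> [|x y [X FX Xx] [Y FY Yy]|a x [X FX Xx]].
    + by exists X0 => //; apply: ideal0.
    + have [iX _ _] : good X by apply: gF => //; exists x.
      have [iY _ _] : good Y by apply: gF => //; exists y.
      have [XY|YX] := Ftot X Y FX FY.
        by exists Y => //; apply: idealD => //; apply: XY.
      by exists X => //; apply: idealD => //; apply: YX.
    + have [iX _ _] : good X by apply: gF => //; exists x.
      by exists X => //; apply: idealMl.
  - by move=> x Qx; exists X0 => //; apply: QX0.
  - move=> x [X FX Xx].
    have [_ _ MX] : good X by apply: gF => //; exists x.
    exact: MX.
have {gA} [iA QA MA] : good A.
  case: gA => // A0; exfalso; apply: (Amax Q); last by right; split.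
  split=> [|/(_ 0 (ideal0 iQ))]; rewrite A0 //; exact: sub0set.
(* By maximality, the ideal generated by [A] and an element outside [A] meets [M]. *)
have mulA x : ~ A x -> exists m r a, [/\ M m, A a & m = a + r * x].
  move=> Ax; pose B := [set z | exists a r, A a /\ z = a + r * x].
  have AB : A `<` B.
    split=> [a Aa|BA]; first by exists a, 0; rewrite mul0r addr0.
    apply: Ax; apply: BA; exists 0, 1; rewrite mul1r add0r.
    by split=> //; apply: ideal0.
  have iB : ideal B.
    apply/idealP; split=> [|u v [a [r [Aa ->]]] [b [s [Ab ->]]]|c u [a [r [Aa ->]]]].
    - exists 0, 0; rewrite mul0r addr0; split=> //; exact: ideal0.
    - exists (a + b), (r + s); split; [exact: idealD|ring].
    - exists (c * a), (c * r); split; [exact: idealMl|ring].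
  apply: contrapT => noM; apply: (Amax B AB); right; split=> //.
    exact: subset_trans (properW AB).
  by move=> z [a [r [Aa zE]]] Mz; apply: noM; exists z, r, a.
exists A; split=> //; apply/prime_idealP; split=> //.
  by move/MA; apply.
move=> x y Axy; apply: contrapT => /not_orP[/mulA[m [r [a [Mm Aa mE]]]]].
move=> /mulA[m' [r' [a' [Mm' Aa' mE']]]].
apply: (MA (m * m')); last exact: MM.
have -> : m * m' = a * m' + r * x * a' + r * r' * (x * y).
  by rewrite mE mE'; ring.
apply: idealD => //; last exact: idealMl.
by apply: idealD => //; [apply: idealMr|apply: idealMl].
Qed.

(** Otherwise [Q] misses the multiplicative set of all [u * x ^+ N] with [u] outside [P]. A prime
    over [Q] missing this set lies in [P] and does not contain [x], against minimality. *)
Lemma minimal_prime_nilp Q P x : ideal Q -> minimal_prime Q P -> P x ->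
  exists u N, ~ P u /\ Q (u * x ^+ N).
Proof.
move=> iQ [pP QP minP] Px; apply: contrapT => no.
pose M := [set z | exists u N, ~ P u /\ z = u * x ^+ N].
have [||z Qz [u [N [Pu zE]]]|P' [pP' QP' MP']] := @prime_avoiding Q M iQ.
- by exists 1, 0%N; rewrite expr0 mulr1; split=> //; apply: prime_ideal1.
- move=> _ _ [u [N [Pu ->]]] [v [N' [Pv ->]]].
  by exists (u * v), (N + N')%N; split; [exact: prime_idealMN|rewrite exprD mulrACA].
- by apply: no; exists u, N; rewrite -zE.
have P'P : P' `<=` P.
  move=> z P'z; apply: contrapT => Pz; apply: (MP' z P'z).
  by exists z, 0%N; rewrite expr0 mulr1.
have P'x : P' x by rewrite (minP P' pP' QP' P'P).
by apply: (MP' x P'x); exists 1, 1%N; rewrite mul1r expr1; split=> //; exact: prime_ideal1.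
Qed.

(** [G] is either [P]-primary in the usual sense or the whole ring; the latter covers contractions
    of zeroth powers. *)
Definition primary P G := [/\ prime_ideal P, ideal G,
  forall a x, ~ P a -> G (a * x) -> G x & forall x, P x -> exists N, G (x ^+ N)].

(* The contraction of [Q S_P] to [S]. *)
Definition contraction P Q : set S := [set x | exists2 s, ~ P s & Q (s * x)].

Lemma contraction_ideal P Q : prime_ideal P -> ideal Q -> ideal (contraction P Q).
Proof.
move=> pP iQ; apply/idealP; split=> [|x y [s Ps Qx] [t Pt Qy]|a x [s Ps Qx]].
- by exists 1; [apply: prime_ideal1 | rewrite mulr0; apply: ideal0].
- exists (s * t); first exact: prime_idealMN.
  have -> : s * t * (x + y) = t * (s * x) + s * (t * y) by ring.
  by apply: idealD => //; apply: idealMl.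
- by exists s => //; rewrite mulrCA; apply: idealMl.
Qed.

Lemma sub_contraction P Q : prime_ideal P -> Q `<=` contraction P Q.
Proof. by move=> pP x Qx; exists 1; rewrite ?mul1r //; apply: prime_ideal1. Qed.

(** An element outside [P] is absorbed into the denominator. Minimality of [P] gives nilpotency:
    from [u * x ^+ N] in [Q], the [m]-th power lies in the [m]-th power of [Q], and [u ^+ m] is
    still outside [P]. *)
Lemma contraction_primary Q P m : ideal Q -> minimal_prime Q P ->
  primary P (contraction P (ideal_pow Q m)).
Proof.
move=> iQ mP; have [pP _ _] := mP; split=> //.
- by apply: contraction_ideal => //; apply: ideal_pow_ideal.
- by move=> a x Pa [s Ps]; exists (s * a); rewrite -?mulrA //; apply: prime_idealMN.
- move=> x /(minimal_prime_nilp iQ mP)[u [N [Pu Qux]]].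
  exists (N * m)%N, (u ^+ m); first by move/(prime_idealX pP).
  by rewrite exprM -exprMn; apply: ideal_powX.
Qed.

End Ideals.

Lemma ideal_preim (S T : comNzRingType) (f : {rmorphism T -> S}) (Q : set S) :
  ideal Q -> ideal (f @^-1` Q).
Proof.
move=> iQ; apply/idealP; split=> [|x y|a x] /=.
- by rewrite rmorph0; apply: ideal0.
- by rewrite rmorphD; apply: idealD.
- by rewrite rmorphM; apply: idealMl.
Qed.

Lemma prime_ideal_preim (S T : comNzRingType) (f : {rmorphism T -> S}) (P : set S) :
  prime_ideal P -> prime_ideal (f @^-1` P).
Proof.
move=> /prime_idealP[iP P1 PM]; apply/prime_idealP; split=> /=.
- exact: ideal_preim.
- by rewrite rmorph1.
- by move=> x y; rewrite rmorphM => /PM.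
Qed.

(** Multiplying by the product of all denominators turns an expression of [f] in the extended ideal
    into one witness [s] outside [P]. Symbolic powers are handled below without fractions. *)
Lemma symbolic_powerP (S : idomainType) (Q : set S) m f : symbolic_power Q m f <->
  forall P, minimal_prime Q P -> contraction P (ideal_pow Q m) f.
Proof.
split=> Hf P mP; have [pP QP _] := mP; have := Hf P mP; last first.
  move=> [s Ps Qsf]; exists 1%N, (fun=> s * f), (fun=> tofrac 1 / tofrac s).
  split=> // [_|]; first by exists 1, s.
  have s0 : tofrac s != 0.
    by rewrite tofrac_eq0; apply/eqP=> s0; apply: Ps; rewrite s0; exact: ideal0 (prime_idealW pP).
  by rewrite big_ord1 tofracM tofrac1; field.
move=> [r [q [c [Qq Pc fE]]]].
have [a aP] := choice Pc; have [s sP] := choice aP.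
exists (\prod_i s i); first by apply: prime_ideal_prodN => // i; case: (sP i).
suff -> : (\prod_i s i) * f = \sum_i (\prod_(j | j != i) s j) * a i * q i.
  apply: (ideal_sum_closed _ (ideal_pow_ideal Q m)) => i _.
  exact: idealMl (ideal_pow_ideal Q m) _.
apply/eqP; rewrite -tofrac_eq tofracM fE mulr_sumr; apply/eqP.
rewrite rmorph_sum; apply: eq_bigr => i _ /=.
have [Psi ->] := sP i.
have s0 : tofrac (s i) != 0.
  by rewrite tofrac_eq0; apply/eqP=> s0; apply: Psi; rewrite s0; exact: ideal0 (prime_idealW pP).
by rewrite (bigD1 i) //= !tofracM; field.
Qed.

Section SymbolicPower.
Variables (S : idomainType) (Q : set S).

Lemma symbolic_power_ideal m : ideal (symbolic_power Q m).
Proof.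
have iC P : minimal_prime Q P -> ideal (contraction P (ideal_pow Q m)).
  by case=> pP _ _; apply: contraction_ideal => //; apply: ideal_pow_ideal.
apply/idealP; split=> [|x y|a x].
- by apply/symbolic_powerP => P mP; exact: ideal0 (iC P mP).
- move=> /symbolic_powerP Hx /symbolic_powerP Hy; apply/symbolic_powerP => P mP.
  by apply: (idealD (iC P mP)); [apply: Hx|apply: Hy].
- move=> /symbolic_powerP Hx; apply/symbolic_powerP => P mP.
  by apply: (idealMl _ (iC P mP)); apply: Hx.
Qed.

Lemma ideal_pow_symbolic m : ideal_pow Q m `<=` symbolic_power Q m.
Proof.
move=> x Qx; apply/symbolic_powerP => P [pP _ _].
exact: sub_contraction.
Qed.

Lemma symbolic_powerM a b x y : symbolic_power Q a x -> symbolic_power Q b y ->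
  symbolic_power Q (a + b) (x * y).
Proof.
move=> /symbolic_powerP Hx /symbolic_powerP Hy; apply/symbolic_powerP => P mP.
have [pP _ _] := mP; have [s Ps Qx] := Hx P mP; have [t Pt Qy] := Hy P mP.
exists (s * t); first exact: prime_idealMN.
by rewrite mulrACA; apply: ideal_powM.
Qed.

End SymbolicPower.

(** * Homogeneity of symbolic powers *)

(** For an ideal [Q], this is its extension to [S[x_1, .., x_n]]. *)
Definition coefs_in (S : comNzRingType) n (Q : set S) : set {mpoly S[n]} :=
  [set f | forall m, Q f@_m].
Arguments coefs_in {S} n Q.

Section CoefsIn.
Variables (S : comNzRingType) (n : nat).
Implicit Types (P Q G : set S) (f g c : {mpoly S[n]}).

Lemma coefs_in_ideal Q : ideal Q -> ideal (coefs_in n Q).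
Proof.
move=> iQ; apply/idealP; split=> [m|f g Qf Qg m|f g Qg m].
- by rewrite mcoeff0; apply: ideal0.
- by rewrite mcoeffD; apply: idealD.
- by rewrite mcoeffM; apply: ideal_sum_closed => // k _; apply: idealMl.
Qed.

Lemma exists_mpoly_filter (p : pred 'X_{1..n}) f :
  exists g : {mpoly S[n]}, forall m, g@_m = if p m then f@_m else 0.
Proof.
exists (\sum_(m <- msupp f | p m) f@_m *: 'X_[m]) => k.
rewrite raddf_sum /=; under eq_bigr do rewrite mcoeffZ mcoeffX.
have [kf|kf] := boolP (k \in msupp f); last first.
  rewrite big_seq_cond big1 => [|m /andP[mf _]]; last first.
    by case: eqVneq mf kf => [-> ->|_ _ _] //; rewrite mulr0.
  by rewrite (memN_msupp_eq0 kf) if_same.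
case: ifP => pk; last first.
  rewrite big1 // => m; case: eqVneq => [->|]; rewrite ?mulr0 //.
  by rewrite pk.
rewrite (big_rem _ kf) /= pk eqxx mulr1 big_seq_cond big1 ?addr0 // => m.
by rewrite mem_rem_uniq ?msupp_uniq // inE => /andP[/andP[/negPf-> _] _]; rewrite mulr0.
Qed.

(* Split [c = c1 + c2] with [c2] the part with coefficients in [P], which is
   nilpotent modulo [G]. As [c g] vanishes modulo [G], so does
   [c1 ^ N g = (- c2) ^ N g] for large [N], and the leading coefficient of
   [c1 ^ N] is not in [P]. *)
Lemma primary_coefs_in P G c g : primary P G ->
  ~ coefs_in n P c -> coefs_in n G (c * g) -> coefs_in n G g.
Proof.
move=> [pP iG Gprim Gnil] Pc Gcg; have iGn := coefs_in_ideal iG.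
have iP := prime_idealW pP.
have [c1 c1E] := exists_mpoly_filter (fun m => ~~ `[< P c@_m >]) c.
have Pc1 m : c1@_m != 0 -> ~ P c1@_m.
  rewrite c1E; case: ifP => [/asboolPn //|]; by rewrite eqxx.
have c1_neq0 : c1 != 0.
  apply/eqP=> c10; apply: Pc => m; apply: contrapT => Pcm.
  have := c1E m; rewrite c10 mcoeff0; case: asboolP => //= _ cm0.
  by apply: Pcm; rewrite -cm0; apply: ideal0 iP.
pose c2 := c - c1.
have Pc2 m : P c2@_m.
  rewrite mcoeffB c1E; case: asboolP => /=; rewrite ?subr0 ?subrr // => _.
  exact: ideal0 iP.
have nilD x y : (exists N, coefs_in n G (x ^+ N)) ->
    (exists N, coefs_in n G (y ^+ N)) -> exists N, coefs_in n G ((x + y) ^+ N).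
  move=> [N Nx] [M My]; exists (N + M)%N; rewrite exprDn.
  apply: (ideal_sum_closed _ iGn) => i _; rewrite -mulr_natl; apply: (idealMl _ iGn).
  have [Mi|iM] := leqP M i.
    by apply: (idealMl _ iGn); rewrite -(subnK Mi) exprD; apply: (idealMl _ iGn).
  have Ni : (N <= N + M - i)%N by lia.
  by apply: (idealMr _ iGn); rewrite -(subnK Ni) exprD; apply: (idealMl _ iGn).
have [N Nc2] : exists N, coefs_in n G (c2 ^+ N).
  rewrite [c2]mpolyE; elim/big_ind: _ => // [|m _].
    by exists 1%N; rewrite expr1; apply: ideal0 iGn.
  have [N GN] := Gnil _ (Pc2 m); exists N => k.
  rewrite -mul_mpolyC exprMn -rmorphXn mul_mpolyC mcoeffZ; exact: idealMr.
have Gd : coefs_in n G (c1 ^+ N * g).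
  suff Gexp j : coefs_in n G (c1 ^+ j * g - (- c2) ^+ j * g).
    have := idealD iGn (Gexp N) (idealMr g iGn (idealMl ((-1) ^+ N) iGn Nc2)).
    by rewrite -exprMn mulN1r subrK.
  elim: j => [|j IHj]; first by rewrite !expr0 subrr; apply: ideal0 iGn.
  have -> : c1 ^+ j.+1 * g - (- c2) ^+ j.+1 * g =
            c1 * (c1 ^+ j * g - (- c2) ^+ j * g) + (- c2) ^+ j * (c * g).
    by rewrite !exprS /c2; ring.
  by apply: (idealD iGn); apply: (idealMl _ iGn).
(* Dropping from [g] the terms with coefficient in [G] leaves [g1], whose leading coefficient is
   outside [G] unless [g1] is zero. *)
have [g1 g1E] := exists_mpoly_filter (fun m => ~~ `[< G g@_m >]) g.
have [g10 m|g1_neq0] := eqVneq g1 0.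
  have := g1E m; rewrite g10 mcoeff0; case: asboolP => //= _ <-; exact: ideal0 iG.
have Gg1 : coefs_in n G (c1 ^+ N * g1).
  have -> : c1 ^+ N * g1 = c1 ^+ N * g - c1 ^+ N * (g - g1) by ring.
  apply: (idealB iGn) => //; apply: (idealMl _ iGn) => m.
  rewrite mcoeffB g1E; case: asboolP => /=; rewrite ?subr0 ?subrr // => _.
  exact: ideal0 iG.
have := Gg1 (mlead c1 *+ N + mlead g1)%MM.
rewrite mleadcMW ?mleadX_le // mleadcX => /Gprim Gl.
have := mlead_supp g1_neq0; rewrite mcoeff_msupp g1E.
case: asboolP => [_|Gl' _]; first by rewrite eqxx.
exfalso; apply: Gl'; have := Gl _; rewrite g1E.
case: asboolP => // Gl'; apply; move/(prime_idealX pP); apply: Pc1.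
by rewrite mleadc_eq0.
Qed.

Lemma prime_primary P : prime_ideal P -> primary P P.
Proof.
move=> pP; split=> // [|a x Pa /(prime_idealM pP)[]//|x Px]; first exact: prime_idealW.
by exists 1%N.
Qed.

Lemma prime_coefs_in P : prime_ideal P -> prime_ideal (coefs_in n P).
Proof.
move=> pP; apply/prime_idealP; split.
- exact: coefs_in_ideal (prime_idealW pP).
- by move/(_ 0%MM); rewrite mcoeff1 eqxx; apply: prime_ideal1.
- move=> x y Pxy; have [Px|Px] := pselect (coefs_in n P x); [by left|right].
  exact: primary_coefs_in (prime_primary pP) Px Pxy.
Qed.

End CoefsIn.

Section Grading.
Variables (k : fieldType) (n : nat).
Implicit Types (f g : {mpoly k[n]}) (Q : set {mpoly k[n]}).

(* [f(t x_1, .., t x_n)], whose coefficients in [t] are the homogeneous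
   components of [f]. *)
Definition dilate : {mpoly k[n]} -> {mpoly {mpoly k[n]}[1]} :=
  mmap (@mpolyC 1 {mpoly k[n]} \o @mpolyC n k) (fun i => ('X_i)%:MP * 'X_ord0).

HB.instance Definition _ := GRing.RMorphism.copy dilate
  (mmap (@mpolyC 1 {mpoly k[n]} \o @mpolyC n k) (fun i => ('X_i)%:MP * 'X_ord0)).

Lemma dilateX m : dilate 'X_[m] = ('X_[m])%:MP * 'X_[U_(ord0) *+ mdeg m].
Proof.
rewrite /dilate mmapX /mmap1.
under eq_bigr do rewrite exprMn.
rewrite big_split /= [in RHS]mpolyXE_id rmorph_prod.
congr (_ * _); first by apply: eq_bigr => i _; rewrite rmorphXn.
by rewrite prodrXr -mdegE mpolyXn.
Qed.

Lemma mcoeff_dilate f m : (dilate f)@_m = pihomog mdeg (mdeg m) f.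
Proof.
elim/mpolyind: f => [|c u f _ _ IHf]; first by rewrite rmorph0 mcoeff0 pihomog0.
have -> : dilate (c *: 'X_[u] + f) = dilate (c *: 'X_[u]) + dilate f by exact: mmapD.
rewrite [LHS]mcoeffD [RHS]pihomogD; congr (_ + _); last exact: IHf.

rewrite (_ : dilate _ = c%:MP%:MP * dilate 'X_[u]); last exact: mmapZ.
rewrite (_ : pihomog _ _ _ = c *: pihomog mdeg (mdeg m) 'X_[u]); last exact: linearZ_LR.
rewrite dilateX pihomogX.
rewrite !mul_mpolyC !mcoeffZ mcoeffX mul_mpolyC mulr_natr.
have -> : (U_(ord0) *+ mdeg u == m)%MM = (mdeg u == mdeg m).
  apply/eqP/eqP => [<-|um]; first by rewrite mdegMn mdeg1 mul1n.
  apply/mnmP=> i; rewrite mulmnE mnm1E (ord1 i) eqxx mul1n um.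
  by rewrite mdegE big_ord1.
by case: eqP; rewrite ?scaler0.
Qed.

Lemma pihomog_dilate f d : pihomog mdeg d f = (dilate f)@_(U_(ord0) *+ d).
Proof. by rewrite mcoeff_dilate mdegMn mdeg1 mul1n. Qed.

(** Homogeneity becomes containment in a preimage under a ring morphism, which is compatible with
    products and with primes. *)
Lemma dilate_homogeneous Q : (forall f, Q f -> forall d, Q (pihomog mdeg d f)) <->
  Q `<=` dilate @^-1` (coefs_in 1 Q).
Proof.
split=> HQ f Qf => [m|d]; first by rewrite mcoeff_dilate; apply: HQ.
by rewrite pihomog_dilate; apply: HQ.
Qed.

Lemma pihomog_sum_closed Q f : ideal Q -> (forall d, Q (pihomog mdeg d f)) -> Q f.
Proof.
move=> iQ Qf; rewrite [f](@pihomog_partitionE _ _ mdeg (msize f)) //.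
exact: ideal_sum_closed.
Qed.

Lemma ideal_pow_homogeneous Q m : homogeneous_ideal Q ->
  homogeneous_ideal (ideal_pow Q m).
Proof.
move=> [iQ hQ]; split; first exact: ideal_pow_ideal.
apply/dilate_homogeneous; apply: ideal_pow_min.
  exact: ideal_preim (coefs_in_ideal _ (ideal_pow_ideal Q m)).
move=> f Qf /=; rewrite rmorph_prod.
have {}Qf i : coefs_in 1 Q (dilate (f i)) by move/dilate_homogeneous: hQ; apply.
elim: m f Qf => [|m IHm] f Qf; first by move=> u; apply: ideal_pow0.
rewrite big_ord_recl => u; rewrite mcoeffM.
apply: (ideal_sum_closed _ (ideal_pow_ideal Q m.+1)) => v _.
by apply: ideal_powS; [apply: Qf | apply: IHm => i; apply: Qf].
Qed.

(** The polynomials all of whose components lie in [P] form a prime, the preimage of [P[t]] under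
    [dilate]. It contains [Q] and lies in [P], so it is [P]. *)
Lemma minimal_prime_homogeneous Q P : homogeneous_ideal Q ->
  minimal_prime Q P -> homogeneous_ideal P.
Proof.
move=> [_ hQ] [pP QP minP]; have iP := prime_idealW pP.
split=> //; apply/dilate_homogeneous.
suff -> : dilate @^-1` (coefs_in 1 P) = P by [].
apply: minP.
- exact: prime_ideal_preim (prime_coefs_in _ pP).
- by move=> f Qf m; apply: QP; move/dilate_homogeneous: hQ; apply.
- move=> f Pf; apply: pihomog_sum_closed => // d.
  by rewrite pihomog_dilate; apply: Pf.
Qed.

(** If [s * f] is in the [m]-th power of [Q] with [s] outside [P], then [dilate s] has a coefficient
    outside [P]. By [primary_coefs_in] it can be cancelled from [dilate s * dilate f] modulo the
    [P]-primary contraction. *)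
Lemma symbolic_power_homogeneous Q m : homogeneous_ideal Q ->
  homogeneous_ideal (symbolic_power Q m).
Proof.
move=> hQ; have [iQ _] := hQ; split=> [|f /symbolic_powerP Qf d].
  exact: symbolic_power_ideal.
apply/symbolic_powerP => P mP; have [s Ps Qsf] := Qf P mP.
have [iP hP] := minimal_prime_homogeneous hQ mP; have [pP _ _] := mP.
have [_ /dilate_homogeneous hQm] := ideal_pow_homogeneous m hQ.
rewrite pihomog_dilate.
apply: (primary_coefs_in (contraction_primary m iQ mP) (c := dilate s)) => [Pds|u].
  apply: Ps; apply: pihomog_sum_closed => // e.
  by rewrite pihomog_dilate; apply: Pds.
by apply: sub_contraction => //; rewrite -rmorphM; apply: hQm.
Qed.

End Grading.

(** * Ideals in a tensor product *)

Section NormalForm.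
Variables (k : fieldType) (p : nat) (G : set {mpoly k[p]}).
Hypothesis iG : ideal G.

(** The monomials outside the initial ideal of [G]; they form a [k]-basis modulo [G]. *)
Definition standard (m : 'X_{1..p}) := forall g, G g -> g != 0 -> mlead g <> m.

Definition normal (f : {mpoly k[p]}) := forall m, f@_m != 0 -> standard m.

Lemma normalP (a : k) f g : normal f -> normal g -> normal (a *: f + g).
Proof.
move=> nf ng m; rewrite mcoeffD mcoeffZ => fgm.
have [fm|] := eqVneq f@_m 0; last exact: nf.
by apply: ng; rewrite fm mulr0 add0r in fgm.
Qed.

Lemma normal0_mem f : normal f -> G f -> f = 0.
Proof.
move=> nf Gf; apply/eqP; apply: contrapT => /negP f0.
by have := nf (mlead f); rewrite mleadc_eq0 => /(_ f0 f Gf f0).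
Qed.

Lemma idealZ (c : k) f : G f -> G (c *: f).
Proof. by rewrite -mul_mpolyC; apply: idealMl. Qed.

Lemma exists_normal f : exists2 r, G (f - r) & normal r.
Proof.
elim/mleadrect: f => f IHf.
have nrm0 : normal 0 by move=> m; rewrite mcoeff0 eqxx.
(* Zero is treated apart: its leading monomial is [0] by convention, which need not be smaller than
   that of [f]. *)
have IHf0 q : q = 0 \/ (mlead q < mlead f)%O -> exists2 r, G (q - r) & normal r.
  move=> [->|/IHf//]; exists 0 => //; rewrite subr0; exact: ideal0 iG.
have [->|f0] := eqVneq f 0; first by apply: IHf0; left.
have [std|] := pselect (standard (mlead f)).
  pose q := f - mleadc f *: 'X_[mlead f].
  have [|r Gqr nr] := IHf0 q.
    by have [|q0] := eqVneq q 0; [left|right; apply: ltm_mleadD].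
  exists (mleadc f *: 'X_[mlead f] + r).
    by rewrite opprD addrA.
  apply: normalP => // m; rewrite mcoeffX.
  by case: (eqVneq (mlead f) m) => [<- //|_]; rewrite eqxx.
move=> /existsNP[g /not_implyP[Gg /not_implyP[g0 gf]]].
have {}gf : mlead g = mlead f by apply: contrapT.
pose q := f - (mleadc f / mleadc g) *: g.
have [|r Gqr nr] := IHf0 q; last first.
  exists r => //; have -> : f - r = (q - r) + (mleadc f / mleadc g) *: g.
    by rewrite addrAC subrK.
  by apply: idealD => //; apply: idealZ.
have [|q0] := eqVneq q 0; [by left|right].
have lc0 : mleadc g != 0 by rewrite mleadc_eq0.
have : (mlead q <= mlead f)%O.
  apply: le_trans (mleadB_le _ _) _; rewrite leUx lexx /= -gf.
  exact: mleadZ_le.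
rewrite le_eqVlt => /orP[/eqP qf|//].
have := mleadc_eq0 q; rewrite qf mcoeffB mcoeffZ gf divfK -?gf //.
by rewrite subrr eqxx (negPf q0).
Qed.

(** A normal element of [G] is zero, so normal forms are unique and any choice of them is linear.
    The coordinates of [h] are functionals that vanish on [G] and together detect membership in
    [G]. *)
Lemma exists_linear_projection : exists h : {linear {mpoly k[p]} -> {mpoly k[p]}},
  (forall f, G (f - h f)) /\ (forall g, G g -> h g = 0).
Proof.
have /choice[h hP] : forall f, exists r, G (f - r) /\ normal r.
  by move=> f; have [r] := exists_normal f; exists r.
have hlin : linear h.
  move=> c f g; apply/eqP; rewrite -subr_eq0; apply/eqP; apply: normal0_mem.
    have [nf ng nfg] := And3 (hP f).2 (hP g).2 (hP (c *: f + g)).2.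
    rewrite -[_ - _]addrC -scaleN1r; apply: normalP => //; exact: normalP.
  have -> : h (c *: f + g) - (c *: h f + h g) =
    c *: (f - h f) + (g - h g) - ((c *: f + g) - h (c *: f + g)).
    by rewrite scalerBr; ring.
  apply: (idealB iG); last exact: (hP _).1.
  apply: (idealD iG); last exact: (hP _).1.
  by apply: idealZ; exact: (hP _).1.
pose hL := GRing.isLinear.Build k _ _ _ h hlin.
pose H : {linear _ -> _} := HB.pack h hL.
exists H; split=> [f|g Gg]; first exact: (hP f).1.
apply: normal0_mem; first exact: (hP g).2.
have -> : H g = g - (g - h g) by rewrite subKr.
by apply: idealB => //; exact: (hP g).1.
Qed.

End NormalForm.

(* [R] is presented as the tensor product over [k] of the polynomial rings [A]
   and [B], through [R -> B[x_1, .., x_n]]; the roles of [A] and [B] will be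
   exchanged. *)
Record tensor_product (k : fieldType) (n p : nat) (R : comNzRingType)
    (iA : {mpoly k[n]} -> R) (iB : {mpoly k[p]} -> R)
    (sig : R -> {mpoly {mpoly k[p]}[n]}) : Prop := TensorProduct {
  tensor_ind : forall K : set R, (forall a b, K (iA a * iB b)) ->
    (forall x y, K x -> K y -> K (x + y)) -> forall x, K x;
  tensorC : forall c, iA c%:MP = iB c%:MP;
  tensor_sig : forall a b m, (sig (iA a * iB b))@_m = a@_m *: b }.

(** * Membership in [F R + G R] tested by linear functionals *)

Section TensorProduct.
Variables (k : fieldType) (n p : nat) (R : comNzRingType).
Local Notation A := {mpoly k[n]}.
Local Notation B := {mpoly k[p]}.
Variables (iA : {rmorphism A -> R}) (iB : {rmorphism B -> R}).
Variable sig : {rmorphism R -> {mpoly B[n]}}.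
Hypothesis tens : tensor_product iA iB sig.
Implicit Types (F I P : set A) (G J : set B) (psi : {scalar B}) (x y : R).

Definition tsum F G : set R := ideal_gen (iA @` F `|` iB @` G).

Lemma tsum_ideal F G : ideal (tsum F G).
Proof. exact: ideal_gen_ideal. Qed.

Lemma tsuml F G a : F a -> tsum F G (iA a).
Proof. by move=> Fa; apply: ideal_gen_sub; left; exists a. Qed.

Lemma tsumr F G b : G b -> tsum F G (iB b).
Proof. by move=> Gb; apply: ideal_gen_sub; right; exists b. Qed.

Lemma tsum_min F G (Q : set R) : ideal Q -> (forall a, F a -> Q (iA a)) ->
  (forall b, G b -> Q (iB b)) -> tsum F G `<=` Q.
Proof.
move=> iQ FQ GQ; apply: ideal_gen_min => // _ [[a Fa <-]|[b Gb <-]]; first exact: FQ.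
exact: GQ.
Qed.

Lemma tsum_mono F F' G G' : F `<=` F' -> G `<=` G' -> tsum F G `<=` tsum F' G'.
Proof.
move=> FF' GG'; apply: tsum_min => [|a /FF'|b /GG']; first exact: tsum_ideal.
  exact: tsuml.
exact: tsumr.
Qed.

Lemma tensor_decomp x : exists s : seq (A * B), x = \sum_(z <- s) iA z.1 * iB z.2.
Proof.
apply: (tensor_ind tens (K := fun x => exists s : seq (A * B),
  x = \sum_(z <- s) iA z.1 * iB z.2)) => [a b|{}x y [s ->] [t ->]].
  by exists [:: (a, b)]; rewrite big_seq1.
by exists (s ++ t); rewrite big_cat.
Qed.

(* [id (x) psi : A (x) B -> A]. *)
Definition contract psi x : A := map_mpoly psi (sig x).

Lemma mcoeff_contract psi x m : (contract psi x)@_m = psi (sig x)@_m.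
Proof. exact: mcoeff_map_mpoly. Qed.

Lemma contractD psi x y : contract psi (x + y) = contract psi x + contract psi y.
Proof.
by apply/mpolyP=> m; rewrite mcoeffD !mcoeff_contract rmorphD mcoeffD linearD.
Qed.

Lemma contract0 psi : contract psi 0 = 0.
Proof. by apply/mpolyP=> m; rewrite mcoeff_contract rmorph0 !mcoeff0 linear0. Qed.

Lemma contract_sum psi (T : Type) (r : seq T) (f : T -> R) :
  contract psi (\sum_(i <- r) f i) = \sum_(i <- r) contract psi (f i).
Proof. exact: (big_morph _ (contractD psi) (contract0 psi)). Qed.

Lemma contractE psi a b : contract psi (iA a * iB b) = psi b *: a.
Proof.
apply/mpolyP=> m; rewrite mcoeff_contract (tensor_sig tens) linearZ /=.
by rewrite mcoeffZ mulrC.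
Qed.

Lemma contractMl psi a x : contract psi (iA a * x) = a * contract psi x.
Proof.
move: x; apply: (tensor_ind tens) => [a' b|x y IHx IHy].
  by rewrite mulrA -rmorphM !contractE scalerAr.
by rewrite !(mulrDr, contractD) IHx IHy.
Qed.

Lemma contractMr psi b x :
  contract psi (iB b * x) = contract (psi \o (b \*o idfun)) x.
Proof.
move: x; apply: (tensor_ind tens) => [a' b'|x y IHx IHy].
  by rewrite mulrCA -rmorphM !contractE.
by rewrite !(mulrDr, contractD) IHx IHy.
Qed.

Definition kills psi G := forall b, G b -> psi b = 0.

Lemma kills_mem G b : ideal G -> (forall psi, kills psi G -> psi b = 0) -> G b.
Proof.
move=> iG Hb; have [h [Gh hG]] := exists_linear_projection iG.
suff hb0 : h b = 0 by have := Gh b; rewrite hb0 subr0.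
apply/mpolyP=> m; rewrite mcoeff0.
by apply: (Hb (mcoeff m \o h)) => c /hG /= ->; rewrite mcoeff0.
Qed.

(** The quotient of [R] by [F R + G R] is the tensor product of [A / F] and [B / G] over the field
    [k]. An element of it is zero once every functional on [B / G] sends it to zero in [A / F]. *)
Lemma tsumP F G x : ideal F -> ideal G ->
  tsum F G x <-> forall psi, kills psi G -> F (contract psi x).
Proof.
move=> iF iG; split=> [|Hx].
  move: x; apply: tsum_min.
  - apply/idealP; split=> [psi _|x y Hx Hy psi kpsi|a x Hx].
    + by rewrite contract0; apply: ideal0.
    + by rewrite contractD; apply: idealD => //; [apply: Hx|apply: Hy].
    + move: a; apply: (tensor_ind tens) => [a b psi kpsi|a a' IHa IHa' psi kpsi].
        rewrite -mulrA contractMl contractMr; apply: idealMl => //.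
        by apply: Hx => b' /(idealMl b iG) /kpsi.
      by rewrite mulrDl contractD; apply: idealD => //; [apply: IHa|apply: IHa'].
  - move=> a Fa psi _; rewrite -[iA a]mulr1 -(rmorph1 iB) contractE.
    exact: idealZ.
  - move=> b Gb psi kpsi; rewrite -[iB b]mul1r -(rmorph1 iA) contractE kpsi //.
    by rewrite scale0r; apply: ideal0.
have [h [Gh hG]] := exists_linear_projection iG.
have [s xE] := tensor_decomp x.
have iFG := tsum_ideal F G.
have -> : x = \sum_(z <- s) iA z.1 * iB (z.2 - h z.2) +
              \sum_(z <- s) iA z.1 * iB (h z.2).
  by rewrite xE -big_split; apply: eq_bigr => z _ /=; rewrite -mulrDr -rmorphD subrK.
apply: (idealD iFG).
  apply: (ideal_sum_closed _ iFG) => z _; apply: (idealMl _ iFG).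
  exact: tsumr.
pose K := \max_(z <- s) msize (h z.2).
have hE (z : A * B) : z \in s ->
    h z.2 = \sum_(m : 'X_{1..p < K}) (h z.2)@_m *: 'X_[m].
  by move=> zs; apply: mpolywE; apply: leq_bigmax_seq.
(* Regrouped by monomials, the coefficient of ['X_[m]] is the contraction of [x] by [mcoeff m \o h],
   a functional that kills [G]. *)
have -> : \sum_(z <- s) iA z.1 * iB (h z.2) =
    \sum_(m : 'X_{1..p < K}) iA (contract (mcoeff m \o h) x) * iB 'X_[m].
  transitivity (\sum_(z <- s) \sum_(m : 'X_{1..p < K})
      iA ((h z.2)@_m *: z.1) * iB 'X_[m]).
    rewrite !big_seq; apply: eq_bigr => z zs.
    rewrite {1}(hE z zs) rmorph_sum mulr_sumr; apply: eq_bigr => m _.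
    rewrite -!mul_mpolyC !rmorphM /= -(tensorC tens); ring.
  rewrite exchange_big; apply: eq_bigr => m _ /=.
  rewrite -mulr_suml -rmorph_sum; congr (iA _ * _).
  by rewrite xE contract_sum; apply: eq_bigr => z _; rewrite contractE.
apply: (ideal_sum_closed _ iFG) => m _; apply: (idealMr _ iFG); apply: tsuml.
by apply: Hx => b /hG /= ->; rewrite mcoeff0.
Qed.

(** Contraction is [A]-linear, so regularity modulo [F] passes through [tsumP]; this expresses
    flatness of [B / G] over [k]. *)
Lemma tsum_regular F G a x : ideal F -> ideal G -> (forall b, F (a * b) -> F b) ->
  tsum F G (iA a * x) -> tsum F G x.
Proof.
move=> iF iG Fa /(tsumP _ iF iG) Hx; apply/(tsumP _ iF iG) => psi kpsi.
by apply: Fa; rewrite -contractMl; apply: Hx.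
Qed.

(** The criterion [tsumP] is a condition on each functional separately, so it commutes with
    arbitrary intersections of the [F t]. *)
Lemma tsum_bigcap (T : Type) (D : set T) (F : T -> set A) G x :
  (forall t, D t -> ideal (F t)) -> ideal (\bigcap_(t in D) F t) -> ideal G ->
  (forall t, D t -> tsum (F t) G x) -> tsum (\bigcap_(t in D) F t) G x.
Proof.
move=> iF iFD iG Hx; apply/(tsumP _ iFD iG) => psi kpsi t Dt.
by move/(tsumP _ (iF t Dt) iG): (Hx t Dt); apply.
Qed.

(* If [P' < iA^-1 Q] were a smaller prime, an element of the difference would be
   nilpotent at [Q] modulo [tsum P' J], but it is regular modulo [tsum P' J]. *)
Lemma minimal_prime_preim I J (Q : set R) : ideal I -> ideal J ->
  minimal_prime (tsum I J) Q -> minimal_prime I (iA @^-1` Q).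
Proof.
move=> iI iJ [pQ IJQ minQ]; split=> [|a Ia|P' pP' IP' P'Q].
- exact: (prime_ideal_preim iA pQ).
- by apply: IJQ; apply: tsuml.
apply/seteqP; split=> // a /= Qa; apply: contrapT => P'a.
have iP' := prime_idealW pP'.
have sub : tsum P' J `<=` Q.
  apply: tsum_min => [|//|b Jb]; first exact: prime_idealW.
  by apply: IJQ; apply: tsumr.
have mQ : minimal_prime (tsum P' J) Q.
  split=> // Q' pQ' P'J; apply: minQ => //; apply: subset_trans P'J.
  exact: tsum_mono.
have [u [N [Qu]]] := minimal_prime_nilp (tsum_ideal P' J) mQ Qa.
rewrite mulrC -rmorphXn => /tsum_regular Hu; apply: Qu; apply: sub; apply: Hu => // y.
by move=> /(prime_idealM pP')[/(prime_idealX pP')|].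
Qed.

Lemma ideal_pow_tsuml I J m a : ideal_pow I m a -> ideal_pow (tsum I J) m (iA a).
Proof.
move: a; apply: ideal_pow_min.
  exact: ideal_preim (ideal_pow_ideal (tsum I J) m).
move=> f If /=; rewrite rmorph_prod; apply: ideal_pow_prod => i.
exact: tsuml.
Qed.

End TensorProduct.

(** * Unmixedness *)

Lemma exists_prime_quotient (S : comNzRingType) (P : set S) : prime_ideal P ->
  exists (K : comNzRingType) (f : {rmorphism S -> K}), forall x, f x = 0 <-> P x.
Proof.
move=> [iP _]; pose Pb : S -> bool := fun x => x \in P.
pose H := isIdealr.Build S Pb iP.
pose PI : idealr S := HB.pack Pb H.
exists ({ideal_quot PI} : comNzRingType), (\pi_({ideal_quot PI}))%qT => x.
have := @Quotient.idealrBE S PI x 0; rewrite subr0 => xE.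
rewrite -(rmorph0 (\pi_({ideal_quot PI}))%qT); split.
  by move/eqP; rewrite -xE => ?; apply: set_mem.
by move=> Px; apply/eqP; rewrite -xE; apply: mem_set.
Qed.

(** Multiplying a relation of degree [d > 0] by the power [d - 1] of its leading coefficient makes
    it monic in [f (c d) * z]. For [d = 0] the relation says that [f (c d)] is zero. *)
Lemma integral_scale_lead (S K : comNzRingType) (f : {rmorphism S -> K})
    (c : nat -> S) d z :
  \sum_(j < d.+1) f (c j) * z ^+ j = 0 -> integralOver f (f (c d) * z).
Proof.
case: d => [|d] Hz.
  move: Hz; rewrite big_ord1 expr0 mulr1 => ->; rewrite mul0r.
  exact: integral0.
pose q := 'X^(d.+1) + \poly_(j < d.+1) (c d.+1 ^+ (d - j) * c j).
exists q.
  rewrite monicE /q lead_coefDl ?lead_coefXn //.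
  by rewrite size_polyXn ltnS size_poly.
apply/rootP; rewrite /q poly_def rmorphD /= map_polyXn hornerD hornerXn.
rewrite rmorph_sum horner_sum /=.
transitivity (f (c d.+1) ^+ d * \sum_(j < d.+2) f (c j) * z ^+ j); last first.
  by rewrite Hz mulr0.
rewrite [in RHS]big_ord_recr /= mulrDr addrC; congr (_ + _); last first.
  by rewrite exprMn exprSr mulrA.
rewrite mulr_sumr; apply: eq_bigr => j _.
rewrite map_polyZ map_polyXn hornerZ hornerXn rmorphM rmorphXn exprMn.
have -> : (f (c d.+1) ^+ d = f (c d.+1) ^+ (d - j) * f (c d.+1) ^+ j)%R.
  by rewrite -exprD subnK // -ltnS.
ring.
Qed.

Lemma mpoly_rmorph_eq (k : nzRingType) n (S : comNzRingType)
    (f g : {rmorphism {mpoly k[n]} -> S}) :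
  (forall c, f c%:MP = g c%:MP) -> (forall i, f 'X_i = g 'X_i) -> f =1 g.
Proof.
move=> fgC fgX; elim/mpolyind => [|c m q _ _ IHq]; first by rewrite !rmorph0.
rewrite !rmorphD IHq -!mul_mpolyC !rmorphM fgC mpolyXE_id !rmorph_prod.
congr (_ * _ + _); apply: eq_bigr => i _; by rewrite !rmorphXn fgX.
Qed.

(** * Independent sets of variables modulo a prime *)

Section Restriction.
Variables (k : fieldType) (n : nat).
Implicit Types (T : {set 'I_n}) (t a : {mpoly k[n]}).

(* The retraction of [k[x_1, .., x_n]] onto [k[x_i | i \in T]]. *)
Definition restr T : {mpoly k[n]} -> {mpoly k[n]} :=
  comp_mpoly [tuple if i \in T then 'X_i else 0 | i < n].

HB.instance Definition _ T := GRing.RMorphism.copy (restr T)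
  (comp_mpoly [tuple if i \in T then 'X_i else 0 | i < n]).

Lemma restrC T c : restr T c%:MP = c%:MP. Proof. exact: comp_mpolyC. Qed.

Lemma restrX T i : restr T 'X_i = if i \in T then 'X_i else 0.
Proof. by rewrite /restr comp_mpolyXU -tnth_nth tnth_mktuple. Qed.

Lemma restrZ T c a : restr T (c *: a) = c *: restr T a.
Proof. by rewrite -!mul_mpolyC rmorphM /= restrC. Qed.

Lemma restr_id T a : restr T (restr T a) = restr T a.
Proof.
move: a; apply: (@mpoly_rmorph_eq _ _ _ (restr T \o restr T) (restr T)) => [c|i] /=.
  by rewrite !restrC.
by rewrite !restrX; case: ifP => iT; rewrite ?rmorph0 // restrX iT.
Qed.

(** The equation [restr T t = t] says that [t] lies in [k[T]], so this is algebraic independence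
    modulo [P] of the variables in [T]. *)
Definition indep (P : set {mpoly k[n]}) T :=
  forall t, restr T t = t -> P t -> t = 0.

Lemma indep_set0 P : prime_ideal P -> indep P finset.set0.
Proof.
move=> pP t tE Pt; have [c tc] : exists c, t = c%:MP.
  rewrite -tE; elim/mpolyind: {tE Pt}t => [|c m q _ _ [e IHq]].
    by exists 0; rewrite rmorph0.
  rewrite rmorphD /= IHq restrZ mpolyXE_id rmorph_prod /=.
  have -> : \prod_(i < n) restr finset.set0 ('X_i ^+ m i) =
      (\prod_(i < n) (0 : k) ^+ m i)%:MP.
    rewrite rmorph_prod; apply: eq_bigr => i _.
    by rewrite !rmorphXn /= restrX finset.in_set0 rmorph0.
  by exists (c * \prod_(i < n) (0 : k) ^+ m i + e); rewrite rmorphD rmorphM mul_mpolyC.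
rewrite tc; have [-> |c0] := eqVneq c 0; first by rewrite rmorph0.
exfalso; apply: (prime_ideal1 pP).
have -> : 1 = c^-1%:MP * t by rewrite tc -rmorphM mulVf // rmorph1.
exact: idealMl (prime_idealW pP) Pt.
Qed.

Lemma exists_max_indep P : prime_ideal P -> exists2 T, indep P T &
  forall i, i \notin T -> ~ indep P (i |: T).
Proof.
move=> pP; pose p T := `[< indep P T >].
have p0 : p finset.set0 by apply/asboolP; apply: indep_set0.
have [T /asboolP iT Tmax] := @arg_maxnP _ _ p (fun T : {set 'I_n} => #|T|) p0.
exists T => // i niT /asboolP /Tmax; rewrite cardsU1 niT /=.
by rewrite add1n ltnn.
Qed.

(** A nonzero element of [P] in the variables of [i |: T] is read through [theta] as a polynomial in
    ['X_i] over [k[T]]. Its leading coefficient is a nonzero element of [k[T]], hence outside [P] by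
    independence. *)
Lemma dependent_relation P T i : indep P T -> ~ indep P (i |: T) ->
  exists (d : nat) (c : nat -> {mpoly k[n]}),
    [/\ forall j, restr T (c j) = c j, ~ P (c d) &
        P (\sum_(j < d.+1) c j * 'X_i ^+ j)].
Proof.
move=> iT /existsNP[t /not_implyP[tE /not_implyP[Pt t0]]].
pose h l : {poly {mpoly k[n]}} := if l \in T then ('X_l)%:P else if l == i then 'X else 0.
pose theta : {mpoly k[n]} -> {poly {mpoly k[n]}} := mmap (polyC \o @mpolyC n k) h.
pose thetaM : {rmorphism {mpoly k[n]} -> {poly {mpoly k[n]}}} :=
  GRing.RMorphism.clone _ _ theta _.
have thetaC c : theta c%:MP = (c%:MP)%:P by rewrite /theta mmapC.
have thetaX l : theta 'X_l = h l by rewrite /theta mmapX mmap1U.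
have theta_eval : (theta t).['X_i] = t.
  rewrite -[RHS]tE; move: {tE Pt t0}t.
  apply: (@mpoly_rmorph_eq _ _ _ (horner_eval 'X_i \o thetaM) (restr (i |: T))) => [c|l] /=.
    by rewrite thetaC restrC /horner_eval hornerC.
  rewrite thetaX restrX /horner_eval finset.in_setU1 /h.
  case: ifP => lT; first by rewrite orbT hornerC.
  by rewrite orbF; case: eqP => [->|_]; rewrite ?hornerX ?horner0.
have theta_restr : map_poly (restr T) (theta t) = theta t.
  move: {tE Pt t0 theta_eval}t.
  apply: (@mpoly_rmorph_eq _ _ _ (map_poly (restr T) \o thetaM) thetaM) => [c|l] /=.
    by rewrite thetaC map_polyC /= restrC.
  rewrite thetaX /h; case: ifP => lT; first by rewrite map_polyC /= restrX lT.
  by case: eqP => _; rewrite ?map_polyX ?rmorph0.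
have th0 : theta t != 0.
  by apply/eqP=> th0; apply: t0; rewrite -theta_eval th0 horner0.
have coefT j : restr T (theta t)`_j = (theta t)`_j by rewrite -[in RHS]theta_restr coef_map.
exists (size (theta t)).-1, (fun j => (theta t)`_j); split=> // [Pl|].
  by have := iT _ (coefT _) Pl; move/eqP; rewrite -lead_coefE lead_coef_eq0 (negPf th0).
by rewrite prednK ?lt0n ?size_poly_eq0 // -horner_coef theta_eval.
Qed.

End Restriction.

Section Unmixed.
Variables (k : fieldType) (n p : nat) (R : comNzRingType).
Local Notation A := {mpoly k[n]}.
Local Notation B := {mpoly k[p]}.
Variables (iA : {rmorphism A -> R}) (iB : {rmorphism B -> R}).
Variable sig : {rmorphism R -> {mpoly B[n]}}.
Hypothesis tens : tensor_product iA iB sig.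
Implicit Types (F : set A) (G : set B) (psi : {scalar B}) (x y : R).
Local Notation tsum := (tsum iA iB).

(** * The subring [k[T] (x) B], as the elements fixed by a retraction [rho] *)

Section Fixed.
Variables (T : {set 'I_n}) (rho : {rmorphism R -> R}).
Hypothesis rhoE : forall a b, rho (iA a * iB b) = iA (restr T a) * iB b.

Lemma rhoA a : rho (iA a) = iA (restr T a).
Proof. by have := rhoE a 1; rewrite !rmorph1 !mulr1. Qed.

Lemma rhoB b : rho (iB b) = iB b.
Proof. by have := rhoE 1 b; rewrite !rmorph1 !mul1r. Qed.

Lemma rho_id x : rho (rho x) = rho x.
Proof.
move: x; apply: (tensor_ind tens) => [a b|x y]; first by rewrite !rhoE restr_id.
by rewrite !rmorphD => -> ->.
Qed.

Lemma contract_rho psi x : contract sig psi (rho x) = restr T (contract sig psi x).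
Proof.
move: x; apply: (tensor_ind tens) => [a b|x y IHx IHy].
  by rewrite rhoE !(contractE tens) restrZ.
by rewrite rmorphD !contractD rmorphD IHx IHy.
Qed.

Lemma coefs_in_contract G x : ideal G -> coefs_in n G (sig x) <->
  forall psi, kills psi G -> contract sig psi x = 0.
Proof.
move=> iG; split=> [Gx psi kpsi|Hx m].
  by apply/mpolyP=> m; rewrite mcoeff_contract mcoeff0; apply: kpsi; apply: Gx.
apply: kills_mem => // psi /Hx Hpsi.
by rewrite -(mcoeff_contract sig) Hpsi mcoeff0.
Qed.

Lemma coefs_in_tsum F G x : ideal F -> ideal G -> coefs_in n G (sig x) -> tsum F G x.
Proof.
move=> iF iG /(coefs_in_contract _ iG) Gx; apply/(tsumP tens _ iF iG) => psi kpsi.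
by rewrite Gx //; apply: ideal0.
Qed.

(* Induction on the number of terms of [x = \sum_j iA (a j) * g j]: a relation
   between the [a j] over [k[T]] modulo [F] shortens the sum, and without
   relations each [c * g j] vanishes modulo [G]. *)
Lemma tsum_subring_regular P1 P2 F G c x : primary P1 F -> primary P2 G ->
  indep P1 T -> rho c = c -> ~ coefs_in n P2 (sig c) ->
  tsum F G (c * x) -> tsum F G x.
Proof.
move=> [pP1 iF Fprim _] primG iT cE P2c; have [_ iG _ _] := primG.
have iFG := tsum_ideal iA iB F G.
have [s ->] := tensor_decomp tens x; rewrite big_tnth.
set a : 'I_(size s) -> A := fun i => (tnth (in_tuple s) i).1.
set g : 'I_(size s) -> R := fun i => iB (tnth (in_tuple s) i).2.
have gE i : rho (g i) = g i by exact: rhoB.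
rewrite -[X in tsum F G (c * X) -> _]/(\sum_i iA (a i) * g i).
rewrite -[X in _ -> tsum F G X]/(\sum_i iA (a i) * g i).
elim: (size s) a g gE => [|r IHr] a g gE Hc.
  by rewrite big_ord0; apply: ideal0 iFG.
have [[t [tE Ft [j0 tj0]]]|indepa] := pselect (exists t : 'I_r.+1 -> A,
  [/\ forall j, restr T (t j) = t j, F (\sum_j t j * a j) & exists j0, t j0 != 0]).
  apply: (tsum_regular tens (a := t j0) iF iG).
    by move=> y; apply: Fprim => /(iT _ (tE j0)) t0; rewrite t0 eqxx in tj0.
  (* Eliminating [a j0] through the relation leaves [r] terms, with coefficients [g'] still fixed by
     [rho]. *)
  pose g' j := iA (t j0) * g (lift j0 j) - iA (t (lift j0 j)) * g j0.
  have sumE : iA (t j0) * \sum_i iA (a i) * g i =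
      iA (\sum_j t j * a j) * g j0 + \sum_j iA (a (lift j0 j)) * g' j.
    have -> : \sum_j iA (a (lift j0 j)) * g' j =
        iA (t j0) * (\sum_j iA (a (lift j0 j)) * g (lift j0 j)) -
        (\sum_j iA (t (lift j0 j) * a (lift j0 j))) * g j0.
      rewrite mulr_sumr mulr_suml -sumrB; apply: eq_bigr => j _.
      by rewrite /g' rmorphM; ring.
    rewrite (bigD1_ord j0) //= [in RHS](bigD1_ord j0) //=.
    by rewrite rmorphD rmorphM rmorph_sum; ring.
  have Fj0 : tsum F G (iA (\sum_j t j * a j) * g j0).
    by apply: (idealMr _ iFG); apply: tsuml.
  rewrite sumE; apply: (idealD iFG) => //; apply: IHr => [j|].
    by rewrite /g' rmorphB !rmorphM !gE !rhoA !tE.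
  apply/(idealBr _ iFG (idealMl c iFG Fj0)).
  by rewrite -mulrDr -sumE mulrCA; apply: idealMl iFG Hc.
apply: (ideal_sum_closed _ iFG) => i _; apply: (idealMl _ iFG).
apply: coefs_in_tsum => //.
apply: (primary_coefs_in primG P2c); rewrite -rmorphM.
apply/(coefs_in_contract _ iG) => psi kpsi; apply/eqP; apply: contrapT => cg0.
(* A functional that kills [G] but not [c * g i] turns the [c * g j] into coefficients in [k[T]] of
   a relation between the [a j] modulo [F], nonzero at [i]. *)
apply: indepa; exists (fun j => contract sig psi (c * g j)); split.
- by move=> j; rewrite -contract_rho rmorphM cE gE.
- move/(tsumP tens _ iF iG): Hc => /(_ psi kpsi).
  rewrite mulr_sumr contract_sum; congr F; apply: eq_bigr => j _.
  by rewrite mulrCA (contractMl tens) mulrC.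
- by exists i; apply/negP.
Qed.

(* A polynomial relation for [z \in P] with coefficients fixed by [rho], stripped
   of its factors [z], would have its constant term in [P] but not in [P']. *)
Lemma rho_relation_mem (P P' : set R) (q : {poly R}) z : prime_ideal P' -> ideal P ->
  P' `<=` P -> (forall x, rho x = x -> P x -> P' x) -> P z ->
  (forall j, rho q`_j = q`_j) -> ~ (forall j, P' q`_j) -> P' q.[z] -> P' z.
Proof.
move=> pP' iP P'P Pfix Pz; have iP' := prime_idealW pP'.
elim/poly_ind: q => [|q c IHq] qfix qP' qz.
  by exfalso; apply: qP' => j; rewrite coef0; apply: ideal0.
have coefS j : (q * 'X + c%:P)`_j.+1 = q`_j by rewrite coefD coefMX coefC addr0.
have coef0 : (q * 'X + c%:P)`_0 = c by rewrite coefD coefMX coefC add0r.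
rewrite hornerD hornerM hornerX hornerC in qz.
have P'c : P' c.
  apply: Pfix; first by have := qfix 0%N; rewrite coef0.
  by apply/(idealBr _ iP (idealMl q.[z] iP Pz)); apply: P'P.
have : P' (q.[z] * z) by rewrite addrC in qz; move: qz => /(idealBr _ iP' P'c).
move=> /(prime_idealM pP')[|//]; apply: IHq => [j|H].
  by rewrite -coefS; apply: qfix.
by apply: qP' => -[|j]; rewrite ?coef0 ?coefS.
Qed.

(** An incomparability argument: modulo [P'], every element of [R] becomes integral over the ring
    fixed by [rho] after multiplication by some [h] of that ring outside [P]. This holds for the
    variables outside [T] by maximality of [T], and is stable under sums and products. For [y] in
    [P], [rho_relation_mem] applied to the monic equation of [h * y] puts it in [P'], and [h]
    cancels. *)
Lemma rho_minimal (P P' : set R) (P1 : set A) : prime_ideal P' -> prime_ideal P ->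
  (forall a, P1 a -> P' (iA a)) -> (forall a, P (iA a) -> P1 a) -> P' `<=` P ->
  (forall x, rho x = x -> P x -> P' x) ->
  indep P1 T -> (forall i, i \notin T -> ~ indep P1 (i |: T)) -> P `<=` P'.
Proof.
move=> pP' pP P1P' PP1 P'P Pfix iT Tmax y Py; have iP' := prime_idealW pP'.
have [K [f fP]] := exists_prime_quotient pP'.
pose Y y := exists h, [/\ rho h = h, ~ P h & integralOver (f \o rho) (f (h * y))].
have Yrho x : rho x = x -> Y x.
  move=> xE; exists 1; rewrite rmorph1 mul1r; split=> //; first exact: prime_ideal1.
  by rewrite -xE; exact: (integral_id (f \o rho)).
have intrho x : rho x = x -> integralOver (f \o rho) (f x).
  by move=> xE; rewrite -xE; exact: (integral_id (f \o rho)).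
have YD u v : Y u -> Y v -> Y (u + v).
  move=> [h [hE Ph hu]] [l [lE Pl lv]]; exists (h * l); split.
  - by rewrite rmorphM hE lE.
  - exact: prime_idealMN.
  have -> : h * l * (u + v) = l * (h * u) + h * (l * v) by ring.
  rewrite rmorphD !rmorphM /=; apply: integral_add.
    by apply: integral_mul; [exact: intrho | rewrite -rmorphM].
  by apply: integral_mul; [exact: intrho | rewrite -rmorphM].
have YM u v : Y u -> Y v -> Y (u * v).
  move=> [h [hE Ph hu]] [l [lE Pl lv]]; exists (h * l); split.
  - by rewrite rmorphM hE lE.
  - exact: prime_idealMN.
  by rewrite mulrACA rmorphM; apply: integral_mul.
have YX i : Y (iA 'X_i).
  have [iinT|/Tmax] := boolP (i \in T).
    by apply: Yrho; rewrite rhoA restrX iinT.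
  move=> /(dependent_relation iT)[d [c [cE P1c P1s]]].
  exists (iA (c d)); split; [by rewrite rhoA cE | by move/PP1 |].
  have -> : f (iA (c d) * iA 'X_i) = (f \o rho) (iA (c d)) * f (iA 'X_i).
    by rewrite /= rhoA cE rmorphM.
  apply: (@integral_scale_lead _ _ (f \o rho) (fun j => iA (c j))).
  have /fP fs0 := P1P' _ P1s; rewrite -[RHS]fs0 !rmorph_sum; apply: eq_bigr => j _ /=.
  by rewrite rhoA cE !rmorphM !rmorphXn.
have YA a : Y (iA a).
  elim/mpolyind: a => [|c m q _ _ IHq].
    by apply: Yrho; rewrite rhoA !rmorph0.
  rewrite -mul_mpolyC rmorphD rmorphM; apply: YD => //; apply: (YM).
    by apply: Yrho; rewrite rhoA restrC.
  rewrite mpolyXE_id rmorph_prod; elim/big_ind: _ => [|u v|i _]; [|exact: (YM)|].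
    by apply: Yrho; rewrite rmorph1.
  rewrite rmorphXn; elim: (m i) => [|j IHj]; first by apply: Yrho; rewrite rmorph1.
  by rewrite exprS; apply: (YM).
have [h [hE Ph [q qmon qroot]]] : Y y.
  move: {Py}y; apply: (tensor_ind tens) => // a b.
  by apply: YM => //; apply: Yrho; apply: rhoB.
have : P' (h * y).
  apply: (@rho_relation_mem P P' (map_poly rho q)) => //; first exact: prime_idealW.
  - exact: idealMl (prime_idealW pP) Py.
  - by move=> j; rewrite coef_map /= rho_id.
  - move/(_ (size q).-1); rewrite coef_map /= -lead_coefE (monicP qmon) rmorph1.
    exact: prime_ideal1.
  - apply/fP; rewrite -horner_map -map_poly_comp; exact/rootP.
by move=> /(prime_idealM pP')[/P'P|].
Qed.

End Fixed.

Hypothesis tens_restr : forall T, exists rho : {rmorphism R -> R},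
  forall a b, rho (iA a * iB b) = iA (restr T a) * iB b.

(** The prime [P] is chosen over the colon ideal and disjoint from the products of an element of
    [k[T] (x) B] outside [P2 R] with an element of [A] outside [P1]. Hence it lies over [P1] and
    [P2]. A smaller prime over [I R + J R] also does, by minimality of these two, and equals [P] by
    [rho_minimal]. *)
Lemma tsum_unmixed I J P1 P2 F G x : ideal I -> ideal J ->
  minimal_prime I P1 -> minimal_prime J P2 -> primary P1 F -> primary P2 G ->
  ~ tsum F G x ->
  exists2 P, minimal_prime (tsum I J) P & forall r, tsum F G (r * x) -> P r.
Proof.
move=> iI iJ [pP1 IP1 minP1] [pP2 JP2 minP2] prF prG FGx.
have [_ iF Fprim Fnil] := prF; have [_ iG Gprim Gnil] := prG.
have [T iT Tmax] := exists_max_indep pP1.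
have [rho rhoE] := tens_restr T.
have iFG := tsum_ideal iA iB F G.
have iP1 := prime_idealW pP1; have iP2 := prime_idealW pP2.
have pP2n := prime_coefs_in n pP2.
pose M := [set z | exists c a, [/\ rho c = c, ~ coefs_in n P2 (sig c), ~ P1 a &
  z = c * iA a]].
pose Q := [set r | tsum F G (r * x)].
have iQ : ideal Q.
  apply/idealP; split=> [|u v|a u]; rewrite /Q /=.
  - by rewrite mul0r; apply: ideal0 iFG.
  - by rewrite mulrDl; apply: idealD iFG.
  - by rewrite -mulrA; apply: idealMl iFG.
have one2 : ~ coefs_in n P2 (sig 1) by rewrite rmorph1; apply: prime_ideal1.
have [||z Qz [c [a [cE P2c P1a zE]]]|P [pP QP PM]] := @prime_avoiding _ Q M iQ.
- exists 1, 1; rewrite !rmorph1 mulr1; split=> //.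
    by rewrite rmorph1 in one2.
  exact: prime_ideal1.
- move=> _ _ [c [a [cE P2c P1a ->]]] [d [b [dE P2d P1b ->]]].
  exists (c * d), (a * b); split.
  + by rewrite rmorphM cE dE.
  + rewrite rmorphM; exact: prime_idealMN.
  + exact: prime_idealMN.
  + by rewrite rmorphM mulrACA.
(* Both [c] and [iA a] are regular modulo [tsum F G], so the colon ideal of [x] misses [M]. *)
- apply: FGx; apply: (tsum_subring_regular rhoE prF prG iT cE P2c).
  apply: (tsum_regular tens (a := a) iF iG) => [b|]; first exact: Fprim.
  by rewrite mulrA (mulrC (iA a)) -zE.
have P1P a : P1 a -> P (iA a).
  move=> /Fnil[N FN]; apply: (prime_idealX (m := N) pP); apply: QP.
  by rewrite -rmorphXn; apply: (idealMr _ iFG); apply: tsuml.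
have P2P b : P2 b -> P (iB b).
  move=> /Gnil[N GN]; apply: (prime_idealX (m := N) pP); apply: QP.
  by rewrite -rmorphXn; apply: (idealMr _ iFG); apply: tsumr.
have PP1 a : P (iA a) -> P1 a.
  move=> Pa; apply: contrapT => P1a; apply: (PM _ Pa).
  by exists 1, a; rewrite mul1r rmorph1; split=> //; rewrite rmorph1 in one2.
have Pfix c : rho c = c -> P c -> coefs_in n P2 (sig c).
  move=> cE Pc; apply: contrapT => P2c; apply: (PM _ Pc).
  exists c, 1; rewrite rmorph1 mulr1; split=> //; exact: prime_ideal1.
have PP2 b : P (iB b) -> P2 b.
  move=> /Pfix /= H; have := H (rhoB rhoE b) 0%MM.
  by rewrite -[iB b]mul1r -(rmorph1 iA) (tensor_sig tens) mcoeff1 eqxx scale1r.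
exists P; last exact: QP.
split=> // [|P' pP' IJP' P'P].
  apply: tsum_min; [exact: prime_idealW | by move=> a /IP1/P1P | by move=> b /JP2/P2P].
have P1E : iA @^-1` P' = P1.
  apply: minP1; first exact: (prime_ideal_preim iA pP').
    by move=> a Ia; apply: IJP'; apply: tsuml.
  by move=> a /P'P/PP1.
have P2E : iB @^-1` P' = P2.
  apply: minP2; first exact: (prime_ideal_preim iB pP').
    by move=> b Jb; apply: IJP'; apply: tsumr.
  by move=> b /P'P/PP2.
have P1P' a : P1 a -> P' (iA a) by rewrite -P1E.
have P2P' b : P2 b -> P' (iB b) by rewrite -P2E.
apply/seteqP; split=> //.
apply: (rho_minimal rhoE pP' pP P1P' PP1 P'P _ iT Tmax) => c cE /(Pfix _ cE).
move=> /(coefs_in_tsum iP1 iP2); move: c {cE}.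
apply: tsum_min => //; exact: prime_idealW.
Qed.

End Unmixed.

(** * Symbolic powers of a sum *)

(** A product of [i] elements of [I] and [m - i] elements of [J] has [i >= a] or [m - i >= b], since
    [a + b = m + 1]. The induction on [m] removes one factor and lowers the exponent of its side. *)
Lemma ideal_pow_tsum (k : fieldType) (n p : nat) (R : comNzRingType)
    (iA : {rmorphism {mpoly k[n]} -> R}) (iB : {rmorphism {mpoly k[p]} -> R})
    (I : set {mpoly k[n]}) (J : set {mpoly k[p]}) m a b : (a + b = m.+1)%N ->
  ideal_pow (tsum iA iB I J) m `<=` tsum iA iB (ideal_pow I a) (ideal_pow J b).
Proof.
pose W a b := tsum iA iB (ideal_pow I a) (ideal_pow J b).
have iW c d : ideal (W c d) by apply: tsum_ideal.
have W0l d x : W 0 d x.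
  rewrite -[x]mulr1; apply: (idealMl _ (iW 0 d)).
  by rewrite -(rmorph1 iA); apply: tsuml; apply: ideal_pow0.
have W0r c x : W c 0 x.
  rewrite -[x]mulr1; apply: (idealMl _ (iW c 0)).
  by rewrite -(rmorph1 iB); apply: tsumr; apply: ideal_pow0.
have stepl c d u x : I u -> W c d x -> W c.+1 d (iA u * x).
  move=> Iu; pose K := [set x | W c.+1 d (iA u * x)].
  suff: W c d `<=` K by apply.
  apply: tsum_min => [|y Iy|y Jy].
  - apply/idealP; split=> [|y z|e y]; rewrite /K /=.
    + by rewrite mulr0; apply: ideal0 (iW _ _).
    + by rewrite mulrDr; apply: idealD (iW _ _).
    + by rewrite mulrCA; apply: idealMl (iW _ _).
  - by rewrite /K /= -rmorphM; apply: tsuml; apply: ideal_powS.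
  - by apply: (idealMl _ (iW _ _)); apply: tsumr.
have stepr c d u x : J u -> W c d x -> W c d.+1 (iB u * x).
  move=> Ju; pose K := [set x | W c d.+1 (iB u * x)].
  suff: W c d `<=` K by apply.
  apply: tsum_min => [|y Iy|y Jy].
  - apply/idealP; split=> [|y z|e y]; rewrite /K /=.
    + by rewrite mulr0; apply: ideal0 (iW _ _).
    + by rewrite mulrDr; apply: idealD (iW _ _).
    + by rewrite mulrCA; apply: idealMl (iW _ _).
  - by apply: (idealMl _ (iW _ _)); apply: tsuml.
  - by rewrite /K /= -rmorphM; apply: tsumr; apply: ideal_powS.
move=> abm; apply: (ideal_pow_min (iW a b)) => f Kf.
elim: m a b abm f Kf => [|m IHm] [|a] [|b] abm f Kf;
  try exact: W0l; try exact: W0r; first by lia.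
rewrite big_ord_recl; set q := \prod_(i < m) _.
have Wl : W a b.+1 q by apply: IHm => [|i]; [lia | apply: Kf].
have Wr : W a.+1 b q by apply: IHm => [|i]; [lia | apply: Kf].
pose K := [set x | W a.+1 b.+1 (x * q)].
suff: tsum iA iB I J `<=` K by apply.
apply: tsum_min => [|y Iy|y Jy]; [|exact: stepl|exact: stepr].
apply/idealP; split=> [|y z|e y]; rewrite /K /=.
- by rewrite mul0r; apply: ideal0 (iW _ _).
- by rewrite mulrDl; apply: idealD (iW _ _).
- by rewrite -mulrA; apply: idealMl (iW _ _).
Qed.

(** * The polynomial ring in both sets of variables as a tensor product *)

Section Inclusions.
Variables (k : fieldType) (n p : nat).
Local Notation A := {mpoly k[n]}.
Local Notation B := {mpoly k[p]}.
Local Notation R := {mpoly k[n + p]}.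
Implicit Types (I F : set A) (J G : set B).

Definition inl_rmorph : A -> R := @inl_mpoly k n p.
HB.instance Definition _ := GRing.RMorphism.copy inl_rmorph
  (comp_mpoly [tuple 'X_(lshift p i) | i < n]).

Definition inr_rmorph : B -> R := @inr_mpoly k n p.
HB.instance Definition _ := GRing.RMorphism.copy inr_rmorph
  (comp_mpoly [tuple 'X_(rshift n i) | i < p]).

Lemma inlC c : inl_rmorph c%:MP = c%:MP. Proof. exact: comp_mpolyC. Qed.
Lemma inrC c : inr_rmorph c%:MP = c%:MP. Proof. exact: comp_mpolyC. Qed.

Lemma inlX i : inl_rmorph 'X_i = 'X_(lshift p i).
Proof. by rewrite /inl_rmorph /inl_mpoly comp_mpolyXU -tnth_nth tnth_mktuple. Qed.

Lemma inrX i : inr_rmorph 'X_i = 'X_(rshift n i).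
Proof. by rewrite /inr_rmorph /inr_mpoly comp_mpolyXU -tnth_nth tnth_mktuple. Qed.

Definition mnml (m : 'X_{1..n + p}) : 'X_{1..n} := [multinom m (lshift p i) | i < n].
Definition mnmr (m : 'X_{1..n + p}) : 'X_{1..p} := [multinom m (rshift n i) | i < p].

Lemma mpolyX_inl_inr m : 'X_[m] = inl_rmorph 'X_[mnml m] * inr_rmorph 'X_[mnmr m].
Proof.
rewrite !mpolyXE_id big_split_ord !rmorph_prod.
congr (_ * _); apply: eq_bigr => i _; rewrite rmorphXn /=.
  by rewrite inlX mnmE.
by rewrite inrX mnmE.
Qed.

Lemma inl_inr_ind (K : set R) : (forall a b, K (inl_rmorph a * inr_rmorph b)) ->
  (forall x y, K x -> K y -> K (x + y)) -> forall x, K x.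
Proof.
move=> KM KD; elim/mpolyind => [|c m q _ _ Kq].
  by have := KM 0 0; rewrite rmorph0 mul0r.
apply: KD => //; rewrite -mul_mpolyC mpolyX_inl_inr mulrA -inlC -rmorphM.
exact: KM.
Qed.

Definition split_l : R -> {mpoly B[n]} := mmap (@mpolyC n B \o @mpolyC p k)
  (fun i => match split i with inl i => 'X_i | inr j => ('X_j)%:MP end).
HB.instance Definition _ := GRing.RMorphism.copy split_l
  (mmap (@mpolyC n B \o @mpolyC p k)
    (fun i => match split i with inl i => 'X_i | inr j => ('X_j)%:MP end)).

Definition split_r : R -> {mpoly A[p]} := mmap (@mpolyC p A \o @mpolyC n k)
  (fun i => match split i with inl i => ('X_i)%:MP | inr j => 'X_j end).
HB.instance Definition _ := GRing.RMorphism.copy split_r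
  (mmap (@mpolyC p A \o @mpolyC n k)
    (fun i => match split i with inl i => ('X_i)%:MP | inr j => 'X_j end)).

Lemma split_l_inl a : split_l (inl_rmorph a) = map_mpoly (@mpolyC p k) a.
Proof.
move: a; apply: (@mpoly_rmorph_eq _ _ _ (split_l \o inl_rmorph)
  (map_mpoly (@mpolyC p k))) => [c|i] /=.
  by rewrite inlC map_mpolyC /split_l mmapC.
by rewrite inlX map_mpolyX /split_l mmapX mmap1U -/(unsplit (inl i)) unsplitK.
Qed.

Lemma split_l_inr b : split_l (inr_rmorph b) = b%:MP.
Proof.
move: b; apply: (@mpoly_rmorph_eq _ _ _ (split_l \o inr_rmorph) (@mpolyC n B)) => [c|i] /=.
  by rewrite inrC /split_l mmapC.
by rewrite inrX /split_l mmapX mmap1U -/(unsplit (inr i)) unsplitK.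
Qed.

Lemma split_r_inr b : split_r (inr_rmorph b) = map_mpoly (@mpolyC n k) b.
Proof.
move: b; apply: (@mpoly_rmorph_eq _ _ _ (split_r \o inr_rmorph)
  (map_mpoly (@mpolyC n k))) => [c|i] /=.
  by rewrite inrC map_mpolyC /split_r mmapC.
by rewrite inrX map_mpolyX /split_r mmapX mmap1U -/(unsplit (inr i)) unsplitK.
Qed.

Lemma split_r_inl a : split_r (inl_rmorph a) = a%:MP.
Proof.
move: a; apply: (@mpoly_rmorph_eq _ _ _ (split_r \o inl_rmorph) (@mpolyC p A)) => [c|i] /=.
  by rewrite inlC /split_r mmapC.
by rewrite inlX /split_r mmapX mmap1U -/(unsplit (inl i)) unsplitK.
Qed.

Lemma tensor_inl_inr : tensor_product inl_rmorph inr_rmorph split_l.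
Proof.
split=> [|c|a b m]; first exact: inl_inr_ind; first by rewrite inlC inrC.
rewrite rmorphM /= split_l_inl split_l_inr mulrC mcoeffCM mcoeff_map_mpoly.
by rewrite mulrC mul_mpolyC.
Qed.

Lemma tensor_inr_inl : tensor_product inr_rmorph inl_rmorph split_r.
Proof.
split=> [K KM KD x|c|a b m]; last 2 first.
- by rewrite inlC inrC.
- rewrite rmorphM /= split_r_inl split_r_inr mulrC mcoeffCM mcoeff_map_mpoly.
  by rewrite mulrC mul_mpolyC.
by apply: (inl_inr_ind (K := K)) => // a b; rewrite mulrC.
Qed.

Lemma inl_inr_restr T : exists rho : {rmorphism R -> R},
  forall a b, rho (inl_rmorph a * inr_rmorph b) = inl_rmorph (restr T a) * inr_rmorph b.
Proof.
pose t := [tuple match split i with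
  | inl i => if i \in T then 'X_(lshift p i) : R else 0 | inr j => 'X_(rshift n j) end
  | i < n + p].
exists (comp_mpoly t) => a b; rewrite rmorphM /=; congr (_ * _).
  move: a; apply: (@mpoly_rmorph_eq _ _ _ (comp_mpoly t \o inl_rmorph)
    (inl_rmorph \o restr T)) => [c|i] /=; first by rewrite inlC comp_mpolyC restrC inlC.
  rewrite inlX restrX comp_mpolyXU -tnth_nth tnth_mktuple.
  rewrite -/(unsplit (inl i)) unsplitK; case: ifP => _; last by rewrite rmorph0.
  by rewrite inlX.
move: b; apply: (@mpoly_rmorph_eq _ _ _ (comp_mpoly t \o inr_rmorph) inr_rmorph)
  => [c|i] /=; first by rewrite inrC comp_mpolyC.
rewrite inrX comp_mpolyXU -tnth_nth tnth_mktuple.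
by rewrite -/(unsplit (inr i)) unsplitK.
Qed.

Lemma ideal_sumE I J : ideal_sum I J = tsum inl_rmorph inr_rmorph I J.
Proof. by []. Qed.

Lemma tsumC F G :
  tsum inl_rmorph inr_rmorph F G = tsum inr_rmorph inl_rmorph G F.
Proof. by rewrite /tsum setUC. Qed.

Lemma symbolic_powerE (S : idomainType) (Q : set S) m :
  symbolic_power Q m = \bigcap_(P in minimal_prime Q) contraction P (ideal_pow Q m).
Proof. by apply/seteqP; split=> f; [move/symbolic_powerP|move=> H; apply/symbolic_powerP]. Qed.

(** For fixed [P1] and [P2], if [f] were outside the sum of the two contractions, [tsum_unmixed]
    would place the colon ideal of [f] in a minimal prime [P] of [I + J]. But some [s] outside [P]
    has [s * f] in the [m]-th power of [I + J], hence in that sum. *)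
Lemma symbolic_power_sum_sub I J m a b : ideal I -> ideal J -> (a + b = m.+1)%N ->
  symbolic_power (ideal_sum I J) m `<=`
  tsum inl_rmorph inr_rmorph (symbolic_power I a) (symbolic_power J b).
Proof.
move=> iI iJ abm f /symbolic_powerP Hf.
have iFI P1 : minimal_prime I P1 -> ideal (contraction P1 (ideal_pow I a)).
  by case=> pP1 _ _; apply: contraction_ideal => //; apply: ideal_pow_ideal.
have iFJ P2 : minimal_prime J P2 -> ideal (contraction P2 (ideal_pow J b)).
  by case=> pP2 _ _; apply: contraction_ideal => //; apply: ideal_pow_ideal.
have H12 P1 P2 : minimal_prime I P1 -> minimal_prime J P2 ->
    tsum inl_rmorph inr_rmorph (contraction P1 (ideal_pow I a))
      (contraction P2 (ideal_pow J b)) f.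
  move=> m1 m2; apply: contrapT => nf.
  have [P mP PP] := tsum_unmixed tensor_inl_inr inl_inr_restr iI iJ m1 m2
    (contraction_primary a iI m1) (contraction_primary b iJ m2) nf.
  have [s Ps Hs] := Hf P mP; apply: Ps; apply: PP.
  have [[pP1 _ _] [pP2 _ _]] := (m1, m2).
  move: Hs => /(ideal_pow_tsum abm); apply: tsum_mono; exact: sub_contraction.
have iI' := symbolic_power_ideal I a; have iJ' := symbolic_power_ideal J b.
have H2 P2 : minimal_prime J P2 -> tsum inl_rmorph inr_rmorph (symbolic_power I a)
      (contraction P2 (ideal_pow J b)) f.
  move=> m2; rewrite symbolic_powerE.
  apply: (tsum_bigcap tensor_inl_inr) => //; last by move=> P1 m1; apply: H12.
    by rewrite -symbolic_powerE.
  exact: iFJ.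
(* Since [tsum_bigcap] intersects in the first factor, the roles of [A] and [B] are exchanged to
   intersect over the minimal primes of [J]. *)
rewrite tsumC (symbolic_powerE J).
apply: (tsum_bigcap tensor_inr_inl) => //; first by rewrite -symbolic_powerE.
by move=> P2 m2; rewrite -tsumC; apply: H2.
Qed.

Lemma symbolic_power_inl I J m f : ideal I -> ideal J -> symbolic_power I m f ->
  symbolic_power (ideal_sum I J) m (inl_rmorph f).
Proof.
move=> iI iJ /symbolic_powerP Hf; apply/symbolic_powerP => Q mQ.
have [s Qs Hs] := Hf _ (minimal_prime_preim tensor_inl_inr iI iJ mQ).
by exists (inl_rmorph s) => //; rewrite -rmorphM; apply: ideal_pow_tsuml.
Qed.

Lemma symbolic_power_inr I J m g : ideal I -> ideal J -> symbolic_power J m g ->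
  symbolic_power (ideal_sum I J) m (inr_rmorph g).
Proof.
rewrite ideal_sumE tsumC.
move=> iI iJ /symbolic_powerP Hg; apply/symbolic_powerP => Q mQ.
have [s Qs Hs] := Hg _ (minimal_prime_preim tensor_inr_inl iJ iI mQ).
by exists (inr_rmorph s) => //; rewrite -rmorphM; apply: ideal_pow_tsuml.
Qed.

End Inclusions.

Arguments inl_rmorph {k n} p f.
Arguments inr_rmorph {k} n {p} g.

(** * Initial degrees *)

Section Alpha.
Variables (k : fieldType) (n : nat).
Implicit Types (Q : set {mpoly k[n]}) (f : {mpoly k[n]}).

Lemma alphaP Q : degrees Q !=set0 ->
  degrees Q (alpha Q) /\ forall e, degrees Q e -> (alpha Q <= e)%N.
Proof.
move=> [d Qd]; have ex : exists d, `[< degrees Q d >] by exists d; apply/asboolP.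
rewrite /alpha; case: xgetP => [//|none].
exfalso; apply: (none (ex_minn ex)); case: ex_minnP => e /asboolP Qe emin.
by split=> // e' Qe'; apply: emin; apply/asboolP.
Qed.

Lemma alpha_le Q d : degrees Q d -> (alpha Q <= d)%N.
Proof. by move=> Qd; have [|_] := @alphaP Q; [exists d | apply]. Qed.

Lemma pihomog_neq0 f m : m \in msupp f -> pihomog mdeg (mdeg m) f != 0.
Proof.
move=> mf; apply: contraTneq mf => f0; rewrite mcoeff_msupp negbK.
rewrite [f](@pihomog_partitionE _ _ mdeg (msize f)) // raddf_sum /= big1 // => i _.
have [<-|im] := eqVneq (mdeg m) i; first by rewrite f0 mcoeff0.
exact: dhomog_nemf_coeff (pihomogP _ _ _) im.
Qed.

Lemma alpha_le_mdeg Q f m : homogeneous_ideal Q -> Q f -> m \in msupp f ->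
  (alpha Q <= mdeg m)%N.
Proof.
move=> [_ hQ] Qf mf; apply: alpha_le; exists (pihomog mdeg (mdeg m) f); split.
- exact: hQ.
- exact: pihomogP.
- exact: pihomog_neq0.
Qed.

(** Powers of a nonzero homogeneous element of [Q] show that [alpha] of a symbolic power is a true
    minimum and not the default value. *)
Lemma degrees_symbolic_power Q m : homogeneous_ideal Q -> Q <> [set 0] ->
  degrees (symbolic_power Q m) !=set0.
Proof.
move=> [iQ hQ] Q0; have [f Qf f0] : exists2 f, Q f & f != 0.
  apply: contrapT => no; apply: Q0; apply/seteqP; split=> f; last first.
    by move=> ->; apply: ideal0.
  by move=> Qf; apply: contrapT => f0; apply: no; exists f => //; apply/eqP.
have [d Qd] : degrees Q !=set0.
  exists (mdeg (mlead f)), (pihomog mdeg (mdeg (mlead f)) f).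
  split; [exact: hQ | exact: pihomogP | apply: pihomog_neq0; exact: mlead_supp].
have [g [Qg gd g0]] := Qd; exists (d * m)%N, (g ^+ m); split.
- by apply: ideal_pow_symbolic; apply: ideal_powX.
- exact: dhomogMn.
- exact: expf_neq0.
Qed.

Lemma alpha_symbolic_power0 Q : alpha (symbolic_power Q 0) = 0%N.
Proof.
apply/eqP; rewrite -leqn0; apply: alpha_le; exists 1; split.
- by apply: ideal_pow_symbolic; apply: ideal_pow0.
- exact: dhomog1.
- exact: oner_neq0.
Qed.

Lemma alpha_symbolic_powerD Q a b : homogeneous_ideal Q -> Q <> [set 0] ->
  (alpha (symbolic_power Q (a + b)) <=
   alpha (symbolic_power Q a) + alpha (symbolic_power Q b))%N.
Proof.
move=> hQ Q0; have dQ m := (alphaP (degrees_symbolic_power m hQ Q0)).1.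
have [[f [Qf fd f0]] [g [Qg gd g0]]] := (dQ a, dQ b).
apply: alpha_le; exists (f * g); split.
- exact: symbolic_powerM.
- exact: dhomogM.
- exact: mulf_neq0.
Qed.

End Alpha.

(** * Degrees in each of the two sets of variables *)

Section Bidegree.
Variables (k : fieldType) (n p : nat).
Local Notation A := {mpoly k[n]}.
Local Notation B := {mpoly k[p]}.
Local Notation R := {mpoly k[n + p]}.

Lemma mdeg_mnml_mnmr (m : 'X_{1..n + p}) : mdeg m = (mdeg (mnml m) + mdeg (mnmr m))%N.
Proof.
by rewrite !mdegE big_split_ord; congr (_ + _)%N; apply: eq_bigr => i _; rewrite mnmE.
Qed.

Lemma mnmlD (m1 m2 : 'X_{1..n + p}) : mnml (m1 + m2) = (mnml m1 + mnml m2)%MM.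
Proof. by apply/mnmP=> i; rewrite !(mnmDE, mnmE). Qed.

Lemma mnmrD (m1 m2 : 'X_{1..n + p}) : mnmr (m1 + m2) = (mnmr m1 + mnmr m2)%MM.
Proof. by apply/mnmP=> i; rewrite !(mnmDE, mnmE). Qed.

Definition mnm_inl (m : 'X_{1..n}) : 'X_{1..n + p} :=
  [multinom match split i with inl j => m j | inr _ => 0%N end | i < n + p].

Definition mnm_inr (m : 'X_{1..p}) : 'X_{1..n + p} :=
  [multinom match split i with inl _ => 0%N | inr j => m j end | i < n + p].

Lemma mnm_inlK m : mnml (mnm_inl m) = m.
Proof.
by apply/mnmP=> i; rewrite !mnmE -/(unsplit (inl i)) unsplitK.
Qed.

Lemma mnm_inrK m : mnmr (mnm_inr m) = m.
Proof.
by apply/mnmP=> i; rewrite !mnmE -/(unsplit (inr i)) unsplitK.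
Qed.

Lemma mnmr_inl m : mnmr (mnm_inl m) = 0%MM.
Proof.
by apply/mnmP=> i; rewrite !mnmE -/(unsplit (inr i)) unsplitK.
Qed.

Lemma mnml_inr m : mnml (mnm_inr m) = 0%MM.
Proof.
by apply/mnmP=> i; rewrite !mnmE -/(unsplit (inl i)) unsplitK.
Qed.

Lemma inlE (f : A) : inl_rmorph p f = \sum_(m <- msupp f) f@_m *: 'X_[mnm_inl m].
Proof.
rewrite {1}[f]mpolyE rmorph_sum; apply: eq_bigr => m _ /=.
rewrite -!mul_mpolyC rmorphM /= inlC mpolyX_inl_inr mnm_inlK mnmr_inl.
by rewrite mpolyX0 rmorph1 mulr1.
Qed.

Lemma inrE (g : B) : inr_rmorph n g = \sum_(m <- msupp g) g@_m *: 'X_[mnm_inr m].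
Proof.
rewrite {1}[g]mpolyE rmorph_sum; apply: eq_bigr => m _ /=.
rewrite -!mul_mpolyC rmorphM /= inrC mpolyX_inl_inr mnm_inrK mnml_inr.
by rewrite mpolyX0 rmorph1 mul1r.
Qed.

Lemma inl_dhomog d (f : A) : f \is d.-homog -> inl_rmorph p f \is d.-homog.
Proof.
move=> /dhomogP fd; rewrite inlE big_seq; apply: rpred_sum => m /fd md.
by apply: rpredZ; rewrite dhomogX /= mdeg_mnml_mnmr mnm_inlK mnmr_inl mdeg0 addn0; apply/eqP.
Qed.

Lemma inr_dhomog d (g : B) : g \is d.-homog -> inr_rmorph n g \is d.-homog.
Proof.
move=> /dhomogP gd; rewrite inrE big_seq; apply: rpred_sum => m /gd md.
by apply: rpredZ; rewrite dhomogX /= mdeg_mnml_mnmr mnm_inrK mnml_inr mdeg0 add0n; apply/eqP.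
Qed.

Lemma inl_neq0 (f : A) : f != 0 -> inl_rmorph p f != 0.
Proof.
apply: contraNneq => f0; apply/eqP/mpolyP => m; rewrite mcoeff0.
have := split_l_inl p f; rewrite f0 rmorph0 => /(congr1 (mcoeff m)).
rewrite mcoeff0 mcoeff_map_mpoly => /eqP; rewrite eq_sym mpolyC_eq0.
by move/eqP.
Qed.

Lemma inr_neq0 (g : B) : g != 0 -> inr_rmorph n g != 0.
Proof.
apply: contraNneq => g0; apply/eqP/mpolyP => m; rewrite mcoeff0.
have := split_r_inr n g; rewrite g0 rmorph0 => /(congr1 (mcoeff m)).
rewrite mcoeff0 mcoeff_map_mpoly => /eqP; rewrite eq_sym mpolyC_eq0.
by move/eqP.
Qed.

(** Multiplication only raises the two partial degrees, so the polynomials whose monomials all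
    satisfy the disjunction form an ideal, and it contains the generators. *)
Lemma tsum_mdeg (F : set A) (G : set B) a b x m :
  (forall f u, F f -> u \in msupp f -> (a <= mdeg u)%N) ->
  (forall g u, G g -> u \in msupp g -> (b <= mdeg u)%N) ->
  tsum (inl_rmorph p) (inr_rmorph n) F G x -> m \in msupp x ->
  (a <= mdeg (mnml m))%N || (b <= mdeg (mnmr m))%N.
Proof.
move=> Fa Gb.
pose K := [set x : R | forall m, m \in msupp x ->
  (a <= mdeg (mnml m))%N || (b <= mdeg (mnmr m))%N].
have iK : ideal K.
  apply/idealP; split=> [u|f g Kf Kg u|f g Kg u].
  - by rewrite msupp0.
  - by move=> /msuppD_le; rewrite mem_cat => /orP[/Kf|/Kg].
  - move=> /msuppM_le /allpairsP[[u1 u2] /= [_ /Kg gu ->]].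
    rewrite mnmlD mnmrD !mdegD.
    by case/orP: gu => H; apply/orP; [left|right]; apply: leq_trans H (leq_addl _ _).
have KX c u : (a <= mdeg (mnml u))%N || (b <= mdeg (mnmr u))%N -> K (c *: 'X_[u]).
  by move=> Hu v /msuppZ_le /mem_msuppXP <-.
suff: tsum (inl_rmorph p) (inr_rmorph n) F G `<=` K by move=> H /H; apply.
apply: tsum_min => // [f Ff|g Gg].
  rewrite -[X in K X]/(inl_rmorph p f) inlE big_seq; apply: ideal_sum_closed => // u uf.
  by apply: KX; rewrite mnm_inlK (Fa _ _ Ff uf).
rewrite -[X in K X]/(inr_rmorph n g) inrE big_seq; apply: ideal_sum_closed => // u ug.
by apply: KX; rewrite mnm_inrK (Gb _ _ Gg ug) orbT.
Qed.

End Bidegree.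

(** * Initial degrees of the symbolic powers of [I + J] *)

Section AlphaSum.
Variables (k : fieldType) (n p : nat) (I : set {mpoly k[n]}) (J : set {mpoly k[p]}).
Hypotheses (homI : homogeneous_ideal I) (I_neq0 : I <> [set 0]).
Hypotheses (homJ : homogeneous_ideal J) (J_neq0 : J <> [set 0]).

Lemma degrees_sum_l m : degrees (symbolic_power (ideal_sum I J) m)
  (alpha (symbolic_power I m)).
Proof.
have [[iI _] [iJ _]] := (homI, homJ).
have [[f [If fd f0]] _] := alphaP (degrees_symbolic_power m homI I_neq0).
exists (inl_rmorph p f); split.
- exact: symbolic_power_inl.
- exact: inl_dhomog.
- exact: inl_neq0.
Qed.

Lemma degrees_sum_r m : degrees (symbolic_power (ideal_sum I J) m)
  (alpha (symbolic_power J m)).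
Proof.
have [[iI _] [iJ _]] := (homI, homJ).
have [[g [Jg gd g0]] _] := alphaP (degrees_symbolic_power m homJ J_neq0).
exists (inr_rmorph n g); split.
- exact: symbolic_power_inr.
- exact: inr_dhomog.
- exact: inr_neq0.
Qed.

(** Fix a monomial [u] of an element of least degree. For every [a <= m + 1], its [x]-degree bounds
    [alpha] of [I^(a)] or its [y]-degree bounds [alpha] of [J^(m + 1 - a)]. The first alternative
    holds at [a = 0]; where it passes to the second between [a] and [a + 1], both bounds hold for
    [a] and [m - a]. If it persists up to [m], take [b = 0]. *)
Lemma alpha_sum_ge m : exists a b, (a + b = m)%N /\
  (alpha (symbolic_power I a) + alpha (symbolic_power J b) <=
   alpha (symbolic_power (ideal_sum I J) m))%N.
Proof.
have [[iI _] [iJ _]] := (homI, homJ).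
have [|[f [Kf /dhomogP fd f0]] _] := @alphaP k (n + p) (symbolic_power (ideal_sum I J) m).
  by exists (alpha (symbolic_power I m)); apply: degrees_sum_l.
have uf := mlead_supp f0; set u := mlead f in uf.
have <- : mdeg u = alpha (symbolic_power (ideal_sum I J) m) := fd u uf.
rewrite mdeg_mnml_mnmr.
have H a b : (a + b = m.+1)%N -> (alpha (symbolic_power I a) <= mdeg (mnml u))%N ||
    (alpha (symbolic_power J b) <= mdeg (mnmr u))%N.
  move=> abm; apply: (tsum_mdeg _ _ (symbolic_power_sum_sub iI iJ abm Kf) uf).
    by move=> g v Ig vg; apply: alpha_le_mdeg Ig vg; apply: symbolic_power_homogeneous.
  by move=> g v Jg vg; apply: alpha_le_mdeg Jg vg; apply: symbolic_power_homogeneous.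
pose found := exists a b, (a + b = m)%N /\
  (alpha (symbolic_power I a) + alpha (symbolic_power J b) <=
   mdeg (mnml u) + mdeg (mnmr u))%N.
have step a : (a <= m)%N -> found \/ (alpha (symbolic_power I a) <= mdeg (mnml u))%N.
  elim: a => [|a IHa] am; first by right; rewrite alpha_symbolic_power0.
  have [|fnd|Ia] := IHa; [exact: ltnW | by left |].
  have [|Ia1|Jb] := orP (H a.+1 (m - a)%N _); [lia | by right | left].
  exists a, (m - a)%N; split; first by rewrite subnKC // ltnW.
  exact: leq_add.
have [//|Im] := step m (leqnn m).
exists m, 0%N; rewrite addn0 alpha_symbolic_power0; split=> //.
exact: leq_add.
Qed.

End AlphaSum.

(** * Fekete's lemma for subadditive sequences *)

Section Fekete.
Variables (R : realType) (u : nat -> nat).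
Hypothesis u_sub : forall a b, (u (a + b) <= u a + u b)%N.

Lemma subadditive_muln q m r : (u (q * m + r) <= q * u m + u r)%N.
Proof.
elim: q => [|q IHq]; first by rewrite !mul0n.
rewrite mulSn -addnA; apply: leq_trans (u_sub _ _) _.
by rewrite mulSn -addnA leq_add2l.
Qed.

(** The limit is the infimum of the quotients. Division with remainder by an index whose quotient is
    within [e / 2] of the infimum bounds [u N] up to a constant [C], and [C / N] is at most [e / 2]
    for large [N]. *)
Lemma fekete : exists L : R,
  (fun m => (u m)%:R / m%:R : R) @ \oo --> L /\ forall m, L * m%:R <= (u m)%:R.
Proof.
(* The shift to [m.+1] leaves out index [0], where the quotient is [0] by the convention on
   division. *)
pose E : set R := [set (u m.+1)%:R / m.+1%:R | m in setT].
have E_inf : has_inf E.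
  split; first by exists ((u 1)%:R / 1%:R), 0%N.
  by exists 0 => _ [m _ <-]; rewrite divr_ge0.
have L_le m : inf E * m%:R <= (u m)%:R.
  case: m => [|m]; first by rewrite mulr0.
  rewrite -ler_pdivlMr ?ltr0n //; apply: ge_inf; first exact: E_inf.2.
  by exists m.
exists (inf E); split=> //; apply/cvgrPdist_le => e e0.
have e20 : 0 < e / 2 by rewrite divr_gt0.
have [_ [m _ <-] um] := inf_adherent e20 E_inf.
(* [C] bounds [u r] for every remainder [r] modulo [m.+1]. *)
pose C := \sum_(r < m.+1) u r.
near=> N.
have N0 : (0 < N)%N by near: N; exact: nbhs_infty_gt.
have N0R : 0 < N%:R :> R by rewrite ltr0n.
have CN : C%:R / (e / 2) <= N%:R.
  by near: N; exact: nbhs_infty_ger.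
rewrite ler_distlC; apply/andP; split.
  by rewrite ler_pdivlMr //; apply: le_trans (L_le N); rewrite ler_pM2r //; lra.
have uN : (u N)%:R <= (N %/ m.+1)%:R * (u m.+1)%:R + C%:R :> R.
  rewrite -natrM -natrD ler_nat {1}(divn_eq N m.+1).
  apply: leq_trans (subadditive_muln _ _ _) _; rewrite leq_add2l /C.
  by rewrite (bigD1 (Ordinal (ltn_pmod N (ltn0Sn m)))) //= leq_addr.
have qN : (N %/ m.+1)%:R <= N%:R / m.+1%:R :> R.
  by rewrite ler_pdivlMr ?ltr0n // -natrM ler_nat leq_divM.
rewrite ler_pdivrMr //; apply: le_trans uN _.
have H1 : (N %/ m.+1)%:R * (u m.+1)%:R <= (inf E + e / 2) * N%:R.
  apply: (@le_trans _ _ (N%:R / m.+1%:R * (u m.+1)%:R)); first by rewrite ler_wpM2r.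
  by rewrite -mulrA [_^-1 * _]mulrC [leLHS]mulrC ler_pM2r // ltW.
rewrite ler_pdivrMr // in CN.
apply: (le_trans (lerD H1 CN)).
by rewrite [N%:R * _]mulrC -mulrDl ler_pM2r //; lra.
Unshelve. all: by end_near.
Qed.

End Fekete.

Theorem corollary3p8 (R : realType) (k : fieldType) (n p : nat)
    (I : set {mpoly k[n]}) (J : set {mpoly k[p]})
    (homI : homogeneous_ideal I) (I_neq0 : I <> [set 0]) (I_proper : I <> setT)
    (homJ : homogeneous_ideal J) (J_neq0 : J <> [set 0]) (J_proper : J <> setT) :
  waldschmidt R (ideal_sum I J) = Num.min (waldschmidt R I) (waldschmidt R J).
Proof.
have [L [cvgL Lle]] := @fekete R (fun m => alpha (symbolic_power I m))
  (fun a b => alpha_symbolic_powerD a b homI I_neq0).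
have [M [cvgM Mle]] := @fekete R (fun m => alpha (symbolic_power J m))
  (fun a b => alpha_symbolic_powerD a b homJ J_neq0).
rewrite /waldschmidt (cvg_lim _ cvgL) // (cvg_lim _ cvgM) //.
apply: cvg_lim => //.
(* For the [a + b = m] given by [alpha_sum_ge], the numerator is at least [L * a + M * b], hence at
   least [Num.min L M * m]. *)
have low m : (0 < m)%N -> Num.min L M <=
    (alpha (symbolic_power (ideal_sum I J) m))%:R / m%:R.
  move=> m0; rewrite ler_pdivlMr ?ltr0n //.
  have [a [b [<- abm]]] := alpha_sum_ge homI I_neq0 homJ m.
  apply: le_trans (_ : _ <= (_ + _)%N%:R) _; last by rewrite ler_nat; exact: abm.
  rewrite !natrD mulrDr; apply: lerD.
    by apply: le_trans (Lle a); rewrite ler_wpM2r // ge_min lexx.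
  by apply: le_trans (Mle b); rewrite ler_wpM2r // ge_min lexx orbT.
(* The upper bound [v] will be the sequence of [I] or of [J], whichever has the smaller limit. *)
have squeeze (v : nat -> nat) :
    (forall m, degrees (symbolic_power (ideal_sum I J) m) (v m)) ->
    (fun m => (v m)%:R / m%:R : R) @ \oo --> Num.min L M ->
    (fun m => (alpha (symbolic_power (ideal_sum I J) m))%:R / m%:R : R) @ \oo -->
      Num.min L M.
  move=> dv cv; apply: (@squeeze_cvgr _ _ _ _ (fun=> Num.min L M)) cv; last exact: cvg_cst.
  near=> m; have m0 : (0 < m)%N by near: m; exact: nbhs_infty_gt.
  rewrite low //= ler_pM2r ?invr_gt0 ?ltr0n // ler_nat; exact: alpha_le.
have [LM|] := boolP (L <= M); last rewrite -ltNge => ML.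
  apply: (squeeze (fun m => alpha (symbolic_power I m))); last by rewrite min_l.
  by move=> m; apply: degrees_sum_l.
apply: (squeeze (fun m => alpha (symbolic_power J m))); last by rewrite min_r // ltW.
by move=> m; apply: degrees_sum_r.
Unshelve. all: by end_near.
Qed.
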